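(* Assume that $V\in\mathscr C^2(\mathbb R^{dn},\mathbb R)$ is bounded with bounded first and second derivatives, and that for all $i=1,\dots,n$, $|\cdot|^{-1}\chi_i\in L^2(\mathbb R^d,\mathbb C)$ and $|\cdot|^{\frac12}\chi_i\in L^2(\mathbb R^d,\mathbb C)$. Then for any Borel probability measure $\mu_0$ on $X^1$ satisfying $$\int_{X^1}\|u\|_{X^1}^2\,d\mu_0(u)<+\infty\quad\text{and}\quad\int_{X^1}\big(|p|^4+\|\alpha\|^4_{\dot{\mathfrak H}^{1/2}}+\|\alpha\|^4_{L^2}\big)\,d\mu_0(u)<+\infty,$$ there exists a constant $c>0$ such that for all times $t\in\mathbb R$, $$\int_{X^1}\big(|p(t)|^4+\|\alpha(t)\|^4_{\dot{\mathfrak H}^{1/2}}\big)\,d\mu_0(u)\le c\quad\text{and}\quad\int_{X^1}\|\alpha(t)\|^4_{L^2}\,d\mu_0(u)\le c\,e^{c|t|},$$ where $(p(t),q(t),\alpha(t))$ is the solution of the Newton--Maxwell equation at time $t$ starting from the initial condition $u=(p,q,\alpha)\in X^1$.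
   Context: Fix integers $n\ge1$, $d\ge3$, masses $m_1,\dots,m_n>0$, a potential $V:\mathbb R^{dn}\to\mathbb R$, and form factors $\chi_i:\mathbb R^d\to\mathbb C$, where $\chi_i(k)=\int e^{2\pi\mathrm i x\cdot k}\varphi_i(x)dx$ is the inverse Fourier transform of a real charge distribution $\varphi_i$ (in particular $\chi_i(-k)=\overline{\chi_i(k)}$). Polarization vectors $\epsilon_\lambda(k)\in\mathbb R^d$, $\lambda=1,\dots,d-1$: $\{\epsilon_1(k),\dots,\epsilon_{d-1}(k),k/|k|\}$ is an orthonormal basis of $\mathbb R^d$ for a.e. $k$. For $\alpha=(\alpha_\lambda):\mathbb R^d\to\mathbb C^{d-1}$: $\|\alpha\|^2_{\dot{\mathfrak H}^\sigma}=\sum_\lambda\int|k|^{2\sigma}|\alpha_\lambda(k)|^2dk$, $\|\alpha\|_{\mathfrak H^\sigma}^2=\sum_\lambda\int(1+|k|^2)^\sigma|\alpha_\lambda(k)|^2dk$; $X^\sigma=\mathbb R^{dn}\times\mathbb R^{dn}\times\mathfrak H^\sigma\ni u=(p,q,\alpha)$ with $\|u\|_{X^\sigma}^2=|p|^2+|q|^2+\|\alpha\|^2_{\mathfrak H^\sigma}$. For $q_i\in\mathbb R^d$, $$A_i(q_i,\alpha)=\sum_{\lambda=1}^{d-1}\int\frac{\epsilon_\lambda(k)}{\sqrt{2|k|}}\Big(\overline{\chi_i(k)}\alpha_\lambda(k)e^{2\pi\mathrm ik\cdot q_i}+\chi_i(k)\overline{\alpha_\lambda(k)}e^{-2\pi\mathrm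 ik\cdot q_i}\Big)dk\in\mathbb R^d .$$ The Newton--Maxwell equation is $$\partial_tp_i=\tfrac1{m_i}\sum_{\nu=1}^d(p_i^\nu-A_i^\nu(q_i,\alpha))\nabla_{q_i}A_i^\nu(q_i,\alpha)-\nabla_{q_i}V(q),\quad\partial_tq_i=\tfrac1{m_i}(p_i-A_i(q_i,\alpha)),$$ $$\mathrm i\partial_t\alpha_\lambda(k)=|k|\alpha_\lambda(k)-\sum_{i=1}^n\tfrac1{m_i}\tfrac{\chi_i(k)}{\sqrt{2|k|}}(p_i-A_i(q_i,\alpha))\cdot\epsilon_\lambda(k)e^{-2\pi\mathrm ik\cdot q_i}.$$ Under the assumptions of the claim, for every $u\in X^1$ it has a unique global strong solution in $\mathscr C(\mathbb R,X^1)\cap\mathscr C^1(\mathbb R,X^0)$ with initial value $u$, depending Borel measurably on $u$ at each time. *)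

(* Defs.v *)
From HB Require Import structures.
From mathcomp Require Import all_boot all_order all_algebra.
From mathcomp Require Import complex.
From mathcomp Require Import all_classical all_reals all_analysis.
From mathcomp Require Import measurable_realfun.

Set Implicit Arguments.
Unset Strict Implicit.
Unset Printing Implicit Defensive.

Import Order.TTheory GRing.Theory Num.Theory.
Import numFieldNormedType.Exports.

Local Open Scope classical_set_scope.
Local Open Scope ring_scope.
Local Open Scope complex_scope.

(* Product sigma-algebra on matrices; over R it is the Borel one. *)
Section matrix_measurable.
Context d (T : measurableType d) (m n : nat).

Definition mx_cylinder : set (set 'M[T]_(m, n)) :=
  [set A | exists i j, exists2 B : set T,
     measurable B & A = (fun M : 'M[T]_(m, n) => M i j) @^-1` B].

HB.instance Definition _ := @isMeasurable.Build (sigma_display mx_cylinder)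
  'M[T]_(m, n) <<s mx_cylinder >>
  (@sigma_algebra0 _ setT mx_cylinder) (@sigma_algebraC _ mx_cylinder)
  (@sigma_algebra_bigcup _ setT mx_cylinder).

Lemma measurable_coord i j : measurable_fun setT (fun M : 'M[T]_(m, n) => M i j).
Proof.
move=> _ B mB; rewrite setTI; apply: sub_sigma_algebra.
by exists i, j, B.
Qed.

Lemma measurable_fun_mx d' (S : measurableType d') (f : S -> 'M[T]_(m, n)) :
  (forall i j, measurable_fun setT (fun x => f x i j)) -> measurable_fun setT f.
Proof.
move=> mf; apply: (@measurability _ _ _ _ setT f mx_cylinder) => //.
move=> _ [_ [i [j [B mB ->]]] <-]; exact: mf.
Qed.

End matrix_measurable.

(* Borel sigma-algebra of C = R^2. *)
Section complex_measurable.
Context (R : realType).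

HB.instance Definition _ := isPointed.Build R[i] 0.

Definition complex_cylinder : set (set R[i]) :=
  [set A | exists2 B : set R,
     measurable B & A = (@complex.Re R) @^-1` B \/ A = (@complex.Im R) @^-1` B].

HB.instance Definition _ := @isMeasurable.Build (sigma_display complex_cylinder)
  R[i] <<s complex_cylinder >>
  (@sigma_algebra0 _ setT complex_cylinder) (@sigma_algebraC _ complex_cylinder)
  (@sigma_algebra_bigcup _ setT complex_cylinder).

Lemma measurable_Re : measurable_fun setT (@complex.Re R).
Proof.
by move=> _ B mB; rewrite setTI; apply: sub_sigma_algebra; exists B => //; left.
Qed.

Lemma measurable_Im : measurable_fun setT (@complex.Im R).
Proof.
by move=> _ B mB; rewrite setTI; apply: sub_sigma_algebra; exists B => //; right.
Qed.

End complex_measurable.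

Section lebesgue_rV.
Context (R : realType).

Definition cons_rV n (x : measurableTypeR R * 'rV[R]_n) : 'rV[R]_n.+1 :=
  row_mx (const_mx (x.1 : R) : 'rV[R]_1) x.2.

Lemma cons_rV0 n x : @cons_rV n x 0 0 = x.1.
Proof. by rewrite /cons_rV mxE; case: splitP => // j _; rewrite mxE. Qed.

Lemma cons_rVS n x j : @cons_rV n x 0 (lift ord0 j) = x.2 0 j.
Proof.
rewrite /cons_rV mxE; case: splitP => [k|k] /=; rewrite /bump /=.
  by case: k => -[].
by rewrite !add1n => -[] /val_inj ->.
Qed.

Lemma measurable_cons_rV n : measurable_fun setT (@cons_rV n).
Proof.
apply: measurable_fun_mx => i j; rewrite (ord1 i).
have [->|[k ->]] : j = 0 \/ exists k, j = lift ord0 k.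
- by case: (unliftP ord0 j) => [k ->|->]; [right; exists k|left].
- rewrite (_ : (fun x => _) = fst); last by apply/funext => x; rewrite cons_rV0.
  exact: measurable_fst.
rewrite (_ : (fun x => _) = (fun M : 'rV[R]_n => M 0 k) \o snd); last first.
  by apply/funext => x; rewrite cons_rVS.
apply: measurableT_comp; first exact: measurable_coord.
exact: measurable_snd.
Qed.

Definition uncons_rV n (v : 'rV[R]_n.+1) : measurableTypeR R * 'rV[R]_n :=
  (v 0 0, \row_j v 0 (lift ord0 j)).

Lemma cons_rVK n : cancel (@cons_rV n) (@uncons_rV n).
Proof.
move=> [x v]; rewrite /uncons_rV cons_rV0; congr (_, _).
by apply/rowP => j; rewrite mxE cons_rVS.
Qed.

Lemma measurable_uncons_rV n : measurable_fun setT (@uncons_rV n).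
Proof.
apply: measurable_fun_pair; first exact: measurable_coord.
apply: measurable_fun_mx => i j; rewrite (ord1 i).
rewrite (_ : (fun x => _) = (fun M : 'rV[R]_n.+1 => M 0 (lift ord0 j))).
  exact: measurable_coord.
by apply/funext => x; rewrite mxE.
Qed.

Section cons_measure.
Context n (mu : {sigma_finite_measure set 'rV[R]_n -> \bar R}).

Definition lebesgue_cons : set 'rV[R]_n.+1 -> \bar R :=
  pushforward (lebesgue_measure \x mu)%E (@cons_rV n).

Let lebesgue_cons0 : lebesgue_cons set0 = 0%E.
Proof. by rewrite /lebesgue_cons /pushforward preimage_set0 measure0. Qed.

Let lebesgue_cons_ge0 A : (0 <= lebesgue_cons A)%E.
Proof. exact: (@measure_ge0 _ _ _ (lebesgue_measure \x mu)%E). Qed.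

Let measurable_cons_preimage A : measurable A -> measurable (@cons_rV n @^-1` A).
Proof. by move=> mA; rewrite -[X in measurable X]setTI; exact: measurable_cons_rV. Qed.

Let lebesgue_cons_sigma_additive : semi_sigma_additive lebesgue_cons.
Proof.
move=> F mF tF mUF; rewrite /lebesgue_cons /pushforward preimage_bigcup.
apply: (@measure_semi_sigma_additive _ _ _ (lebesgue_measure \x mu)%E).
- by move=> k; exact: measurable_cons_preimage.
- apply/trivIsetP => /= i j _ _ ij; rewrite -preimage_setI.
  by move/trivIsetP : tF => /(_ _ _ _ _ ij) ->//; rewrite preimage_set0.
- by rewrite -preimage_bigcup; exact: measurable_cons_preimage.
Qed.

HB.instance Definition _ := isMeasure.Build _ _ _ lebesgue_cons
  lebesgue_cons0 lebesgue_cons_ge0 lebesgue_cons_sigma_additive.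

Let lebesgue_cons_sigma_finite : sigma_finite setT lebesgue_cons.
Proof.
have /sigma_finiteP[F [TF ndF Foo]] := sigma_finiteT (@lebesgue_measure R).
have /sigma_finiteP[G [TG ndG Goo]] := sigma_finiteT mu.
exists (fun k => @uncons_rV n @^-1` (F k `*` G k)).
  rewrite -preimage_bigcup (_ : \bigcup_k (F k `*` G k) = setT) ?preimage_setT//.
  apply/seteqP; split => // -[x y] _.
  have [i _ Fx] : (\bigcup_k F k) x by rewrite -TF.
  have [j _ Gy] : (\bigcup_k G k) y by rewrite -TG.
  exists (maxn i j) => //; split.
  - by move: x Fx; exact/subsetPset/ndF/leq_maxl.
  - by move: y Gy; exact/subsetPset/ndG/leq_maxr.
move=> k; have [mF Fk] := Foo k; have [mG Gk] := Goo k.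
split.
  rewrite -[X in measurable X]setTI; apply: measurable_uncons_rV => //.
  exact: measurableX.
rewrite /lebesgue_cons /pushforward -comp_preimage.
rewrite (_ : _ \o _ = id) ?preimage_id; last first.
  by apply/funext => x /=; rewrite cons_rVK.
by rewrite product_measure1E// lte_mul_pinfty// ge0_fin_numE.
Qed.

HB.instance Definition _ := @Measure_isSigmaFinite.Build _ _ _ lebesgue_cons
  lebesgue_cons_sigma_finite.

End cons_measure.

(* Lebesgue measure on R^n as an iterated product; see lebesgue_rV_box. *)
Fixpoint lebesgue_rV n : {sigma_finite_measure set 'rV[R]_n -> \bar R} :=
  if n is k.+1 then lebesgue_cons (lebesgue_rV k)
  else (\d_(0 : 'rV[R]_0))%R.

Lemma lebesgue_rV_box n (A : 'I_n -> set R) : (forall i, measurable (A i)) ->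
  lebesgue_rV n [set v | forall i, A i (v 0 i)] =
  (\prod_(i < n) lebesgue_measure (A i))%E.
Proof.
elim: n A => [|n IH] A mA.
  by rewrite big_ord0 /= diracE (_ : (0 \in _) = true)//; apply/mem_set => -[].
rewrite big_ord_recl -IH //= /lebesgue_cons /pushforward.
rewrite -(@product_measure1E _ _ _ _ _ lebesgue_measure (lebesgue_rV n))//.
- congr (_ _); apply/seteqP; split => [[x v]|[x v]] /=.
    move=> h; split; first by have := h ord0; rewrite cons_rV0.
    by move=> i; have := h (lift ord0 i); rewrite cons_rVS.
  move=> [hx hv] i; case: (unliftP ord0 i) => [k ->|->].
    by rewrite cons_rVS.
  by rewrite cons_rV0.
- exact: mA.
rewrite [X in measurable X](_ : _ =
    \bigcap_i ((fun v : 'rV[R]_n => v 0 i) @^-1` (A (lift ord0 i)))); last first.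
  by apply/seteqP; split => v h // i; have := h i; exact.
apply: fin_bigcap_measurable => // i _.
by rewrite -[X in measurable X]setTI; exact: measurable_coord.
Qed.

End lebesgue_rV.

(* The library norm on matrices is the sup norm, hence a Euclidean norm here.
   R^{dn} is the space of n x d matrices, q_i being the i-th row. *)
Section euclidean.
Context (R : realType).

Definition sqnorm m n (M : 'M[R]_(m, n)) : R := \sum_i \sum_j M i j ^+ 2.

Definition enorm m n (M : 'M[R]_(m, n)) : R := Num.sqrt (sqnorm M).

Definition dotp n (x y : 'rV[R]_n) : R := \sum_j x 0 j * y 0 j.

Definition sqmod (z : R[i]) : R := complex.Re z ^+ 2 + complex.Im z ^+ 2.

Definition csqnorm n (z : 'rV[R[i]]_n) : R := \sum_j sqmod (z 0 j).

Definition expi (x : R) : R[i] := cos x +i* sin x.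

Lemma measurable_sqnorm n : measurable_fun setT (@sqnorm 1 n).
Proof.
rewrite /sqnorm; apply: measurable_sum => i; apply: measurable_sum => j.
apply: measurable_funX; exact: measurable_coord.
Qed.

Lemma measurable_enorm n : measurable_fun setT (@enorm 1 n).
Proof.
rewrite (_ : @enorm _ _ = (@Num.sqrt R : R -> R) \o @sqnorm 1 n)//.
apply: measurableT_comp; last exact: measurable_sqnorm.
by apply: continuous_measurable_fun => x; exact: sqrt_continuous.
Qed.

Lemma measurable_csqnorm n : measurable_fun setT (@csqnorm n).
Proof.
rewrite /csqnorm; apply: measurable_sum => j; apply: measurable_funD; apply: measurable_funX.
  by apply: measurableT_comp; [exact: measurable_Re|exact: measurable_coord].
by apply: measurableT_comp; [exact: measurable_Im|exact: measurable_coord].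
Qed.

Lemma csqnorm_ge0 n (z : 'rV[R[i]]_n) : 0 <= csqnorm z.
Proof. by apply: sumr_ge0 => j _; rewrite addr_ge0 ?sqr_ge0. Qed.

End euclidean.

(* delta_mx i j is the (i, j) vector of the canonical basis of R^{mn}. *)
Section differential.
Context (R : realType) (m n : nat).
Implicit Type f : 'M[R]_(m, n) -> R.

Definition partial i j f : 'M[R]_(m, n) -> R := 'D_(delta_mx i j) f.

Definition class_C1 f := continuous f /\
  forall i j, (forall x, derivable f x (delta_mx i j)) /\ continuous (partial i j f).

Definition class_C2 f := class_C1 f /\ forall i j, class_C1 (partial i j f).

Definition row_grad i f (x : 'M[R]_(m, n)) : 'rV[R]_n := \row_j partial i j f x.

End differential.

Section fields.
Context (R : realType) (d : nat).
Notation momentum := 'rV[R]_d.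
Notation leb := (lebesgue_rV R d).

(* Squared norms: a fourth power of a norm is a square of one of these. *)
Definition weighted_sqnorm (w : momentum -> R) (f : momentum -> 'rV[R[i]]_d.-1) :
  \bar R := (\int[leb]_k (w k * csqnorm (f k))%:E)%E.

Definition Hdot_sqnorm (s : R) := weighted_sqnorm (fun k => enorm k `^ (2 * s)).

Definition H_sqnorm (s : R) := weighted_sqnorm (fun k => (1 + enorm k ^+ 2) `^ s).

Definition L2_sqnorm := weighted_sqnorm (fun=> 1).

(* Measurable functions R^d -> C^{d-1} modulo a.e. equality. field_fun picks a
   representative; every formula below only depends on the class. *)
Definition field := {mfun_ leb, momentum >-> 'rV[R[i]]_d.-1}.

Definition field_fun (a : field) : momentum -> 'rV[R[i]]_d.-1 := repr a.

End fields.

Coercion field_fun : field >-> Funclass.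

Section phase_space.
Context (R : realType) (n d : nat) (s : R).

Record phase_space := PhaseSpace {
  mom : 'M[R]_(n, d);
  pos : 'M[R]_(n, d);
  fld : field R d;
  fld_fin : (H_sqnorm s (fld : 'rV[R]_d -> 'rV[R[i]]_d.-1) < +oo)%E }.

HB.instance Definition _ := gen_eqMixin phase_space.
HB.instance Definition _ := gen_choiceMixin phase_space.

End phase_space.

Arguments phase_space : clear implicits.

Section phase_space_borel.
Context (R : realType) (n d : nat) (s : R).

Local Open Scope quotient_scope.

Lemma measurable_H_integrand (f : 'rV[R]_d -> 'rV[R[i]]_d.-1) :
  measurable_fun setT f -> measurable_fun setT
    (fun k => (((1 + enorm k ^+ 2) `^ s) * csqnorm (f k))%:E).
Proof.
move=> mf; apply/measurable_EFinP; apply: measurable_funM.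
  apply: (@measurableT_comp _ _ _ _ _ _ (@powR R ^~ s)).
    exact: measurable_powR.
  apply: measurable_funD => //; apply: measurable_funX; exact: measurable_enorm.
by apply: measurableT_comp => //; exact: measurable_csqnorm.
Qed.

Definition field0 : field R d :=
  \pi_(field R d) (cst 0 : {mfun 'rV[R]_d >-> 'rV[R[i]]_d.-1}).

Lemma field0_fin : (H_sqnorm s field0 < +oo)%E.
Proof.
have h : field0 = cst 0 %[ae lebesgue_rV R d].
  have : ae_eq_op (lebesgue_rV R d) (repr field0) (cst 0).
    by rewrite -eqmodE reprK.
  by move/asboolP.
rewrite /H_sqnorm /weighted_sqnorm (@ae_eq_integral _ _ _ _ _ (cst 0%E))//.
- by rewrite integral_cst// mul0e.
- by apply: measurable_H_integrand; exact: measurable_funPT.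
- apply: filterS h => k /(_ I) /= -> _; rewrite /csqnorm big1 ?mulr0// => j _.
  by rewrite mxE /sqmod expr0n addr0.
Qed.

HB.instance Definition _ := isPointed.Build (phase_space R n d s)
  (PhaseSpace 0 0 field0_fin).

Definition X_sqnorm (p q : 'M[R]_(n, d)) (a : 'rV[R]_d -> 'rV[R[i]]_d.-1) : \bar R :=
  ((enorm p ^+ 2 + enorm q ^+ 2)%:E + H_sqnorm s a)%E.

Definition X_sqdist (u v : phase_space R n d s) : \bar R :=
  X_sqnorm (mom u - mom v) (pos u - pos v) (fun k => fld u k - fld v k).

(* Open sets of the norm topology of X^s. *)
Definition X_open : set (set (phase_space R n d s)) :=
  [set A | forall u, A u -> exists2 e : R, 0 < e &
     forall v, (X_sqdist u v < (e ^+ 2)%:E)%E -> A v].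

HB.instance Definition _ := @isMeasurable.Build (sigma_display X_open)
  (phase_space R n d s) <<s X_open >>
  (@sigma_algebra0 _ setT X_open) (@sigma_algebraC _ X_open)
  (@sigma_algebra_bigcup _ setT X_open).

End phase_space_borel.

Section newton_maxwell.
Context (R : realType) (n d : nat).
Notation momentum := 'rV[R]_d.
Notation leb := (lebesgue_rV R d).

Definition square_integrable (f : momentum -> R[i]) :=
  measurable_fun setT f /\ (\int[leb]_k (sqmod (f k))%:E < +oo)%E.

(* The integral of exp(2 pi i x.k) f(x) dx is the L^2 limit of the integrals over
   balls. When chi is square integrable this covers the case of f in L^1, where
   the integral converges absolutely, and all of f in L^2. *)
Definition truncated_inverse_fourier (f : momentum -> R) (r : R) (k : momentum) : R[i] :=
  let ball := [set x : momentum | enorm x <= r] in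
  (\int[leb]_(x in ball) (f x * cos (2 * pi * dotp x k)))
  +i* (\int[leb]_(x in ball) (f x * sin (2 * pi * dotp x k))).

Definition inverse_fourier (f : momentum -> R) (chi : momentum -> R[i]) :=
  (forall r, leb.-integrable [set x : momentum | enorm x <= r] (EFin \o f)) /\
  (\int[leb]_k (sqmod (chi k - truncated_inverse_fourier f r k))%:E)%E
    @[r --> +oo] --> 0%E.

Definition polarization_vectors (eps : 'I_d.-1 -> momentum -> momentum) :=
  (forall l, measurable_fun setT (eps l)) /\
  {ae leb, forall k,
    let frame := col_mx (\matrix_(l < d.-1) eps l k) ((enorm k)^-1 *: k) in
    frame *m frame^T = 1%:M /\ row_full frame}.

Context (m : 'I_n -> R) (V : 'M[R]_(n, d) -> R) (chi : 'I_n -> momentum -> R[i])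
  (eps : 'I_d.-1 -> momentum -> momentum).

(* The integrand has the form z + conj z, so that complex.Re only changes its type. *)
Definition vector_potential (i : 'I_n) (x : 'rV[R]_d)
    (a : momentum -> 'rV[R[i]]_d.-1) : 'rV[R]_d :=
  \row_nu \sum_l \int[leb]_k
    (eps l k 0 nu / Num.sqrt (2 * enorm k) *
     complex.Re ((chi i k)^* * a k 0 l * expi (2 * pi * dotp k x) +
                 chi i k * (a k 0 l)^* * expi (- (2 * pi * dotp k x)))).

Definition velocity (p q : 'M[R]_(n, d)) (a : momentum -> 'rV[R[i]]_d.-1)
    (i : 'I_n) : 'rV[R]_d :=
  (m i)^-1 *: (row i p - vector_potential i (row i q) a).

Definition force (p q : 'M[R]_(n, d)) (a : momentum -> 'rV[R[i]]_d.-1)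
    (i : 'I_n) : 'rV[R]_d :=
  (m i)^-1 *: (\sum_nu (p i nu - vector_potential i (row i q) a 0 nu) *:
                 row_grad 0 (fun x => vector_potential i x a 0 nu) (row i q))
  - row_grad i V q.

Definition current (p q : 'M[R]_(n, d)) (a : momentum -> 'rV[R[i]]_d.-1)
    (l : 'I_d.-1) (k : momentum) : R[i] :=
  \sum_i ((m i)^-1)%:C * (chi i k / (Num.sqrt (2 * enorm k))%:C) *
    (dotp (row i p - vector_potential i (row i q) a) (eps l k))%:C *
    expi (- (2 * pi * dotp k (row i q))).

Definition newton_maxwell (u : phase_space R n d 1) (v : phase_space R n d 0) :=
  [/\ forall i, row i (mom v) = force (mom u) (pos u) (fld u) i,
      forall i, row i (pos v) = velocity (mom u) (pos u) (fld u) i &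
      {ae leb, forall k l, 'i * fld v k 0 l =
        (enorm k)%:C * fld u k 0 l - current (mom u) (pos u) (fld u) l k}].

Definition X0_derivative (u : R -> phase_space R n d 1) (t : R)
    (v : phase_space R n d 0) :=
  X_sqnorm 0 (h^-1 *: (mom (u (t + h)) - mom (u t)) - mom v)
             (h^-1 *: (pos (u (t + h)) - pos (u t)) - pos v)
             (fun k => (h^-1)%:C *: (fld (u (t + h)) k - fld (u t) k) - fld v k)
    @[h --> 0^'] --> 0%E.

Definition strong_solution (u : R -> phase_space R n d 1) :=
  (forall t, X_sqdist (u s) (u t) @[s --> t] --> 0%E) /\
  exists v : R -> phase_space R n d 0,
    [/\ forall t, X0_derivative u t (v t),
        forall t, X_sqdist (v s) (v t) @[s --> t] --> 0%E &
        forall t, newton_maxwell (u t) (v t)].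

End newton_maxwell.

(* Main.v *)
Require Import Defs.
From HB Require Import structures.
From mathcomp Require Import all_boot all_order all_algebra.
From mathcomp Require Import complex.
From mathcomp Require Import all_classical all_reals all_analysis.
From mathcomp Require Import measurable_realfun.
From mathcomp Require Import ring lra.

Set Implicit Arguments.
Unset Strict Implicit.
Unset Printing Implicit Defensive.

Import Order.TTheory GRing.Theory Num.Theory.
Import numFieldNormedType.Exports.

Local Open Scope classical_set_scope.
Local Open Scope ring_scope.
Local Open Scope complex_scope.

(** Why the moments are controlled.

    The energy, which is the kinetic energy sum of |p_i - A_i|^2 / (2 m_i), plus V, plus the
    field energy (the squared norm of alpha in the homogeneous Sobolev space of order 1/2), is
    constant along strong solutions. Since V is bounded, the energy bounds the field energy and
    every |p_i - A_i|. The Cauchy-Schwarz inequality with |k|^(1/2) moved onto alpha gives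
    |A_i|^2 <= const * field energy, because |k|^-1 chi_i is square integrable; so the energy is
    comparable, up to additive constants, with D = |p|^2 + field energy. Hence
    D(t) <= C (1 + D(0)) with C independent of the solution, and squaring and integrating gives
    the first bound. For the second one, the free evolution is unitary and the current is
    bounded in L2 by the velocities, that is, by the energy; the squared L2 norm N of alpha
    satisfies |N'| <= N + C (1 + D(0)), and Gronwall's lemma gives exponential growth.

    Conservation of the energy must be proved for solutions that are only differentiable in X^0.
    The vector potential is written as a real inner product A_i(q, alpha) = < g_i(q), alpha > in
    L2, where g_i(q) is a plane wave modulated by the form factor. The map g_i is differentiable
    along differentiable curves, by dominated convergence and because |k|^(1/2) chi_i is square
    integrable (coupling_derive). From there on, the computation takes place in an abstract real
    vector space with a nonnegative symmetric form (energy_derive), and so do the estimates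
    (energy_bounds). The field energy < |k| alpha, alpha > is differentiated thanks to the
    symmetry of the multiplication by |k| and the continuity of |k| alpha, which comes from X^1
    (is_derive_inner_sym).

    The pointwise bounds are then integrated against mu0 (integral_le_affine), in a form valid
    for arbitrary nonnegative integrands, since those at time t are composed with the flow. *)

(** * Limits and derivatives on the real line *)

Section line.
Context (R : realType).

Lemma cvg0_le (I : Type) (F : set_system I) (FF : Filter F)
    (f : I -> R) (g : I -> \bar R) :
  (forall i, 0 <= f i) -> (forall i, ((f i)%:E <= g i)%E) ->
  g i @[i --> F] --> 0%E -> f i @[i --> F] --> (0 : R).
Proof.
move=> f0 fg g0; apply: (@fine_cvg _ _ _ _ (EFin \o f)).
apply: (@squeeze_cvge _ _ _ _ (cst 0%E) _ g) => //; last exact: cvg_cst.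
by apply: nearW => i /=; rewrite lee_fin f0 fg.
Qed.

Lemma cvg_sqr0 (I : Type) (F : set_system I) (FF : Filter F) (f : I -> R) (l : R) :
  (f i - l) ^+ 2 @[i --> F] --> (0 : R) -> f i @[i --> F] --> l.
Proof.
move=> /cvgr0Pnorm_lt h; apply/cvgrPdist_lt => e e0.
have := h _ (exprn_gt0 2 e0); apply: filterS => i.
rewrite normrX ltr_pXn2r ?nnegrE ?normr_ge0 ?(ltW e0)//.
by rewrite distrC.
Qed.

Lemma cvg_sumR (T I : Type) (F : set_system T) (FF : Filter F) (r : seq I)
    (f : I -> T -> R) (l : I -> R) : (forall i, f i x @[x --> F] --> l i) ->
  \sum_(i <- r) f i x @[x --> F] --> \sum_(i <- r) l i.
Proof.
move=> fl; elim: r => [|i r IH].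
  by under eq_fun do rewrite big_nil; rewrite big_nil; exact: cvg_cst.
by under eq_fun do rewrite big_cons; rewrite big_cons; apply: cvgD.
Qed.

Lemma cvg_dnbhs_diffquot (f : R -> R) (l : R) :
  h^-1 * f h @[h --> (0 : R)^'] --> l -> f h @[h --> (0 : R)^'] --> (0 : R).
Proof.
move=> fl; have h0 : h * (h^-1 * f h) @[h --> (0 : R)^'] --> (0 : R).
  by rewrite -[X in _ --> X](mul0r l); apply: cvgM => //; exact: nbhs_dnbhs.
apply: cvg_trans h0; apply: near_eq_cvg; near=> h.
by rewrite mulrA mulfV ?mul1r//; near: h; exact: nbhs_dnbhs_neq.
Unshelve. all: by end_near. Qed.

Lemma is_derive_dnbhs (f : R -> R) (t l : R) :
  h^-1 * (f (t + h) - f t) @[h --> (0 : R)^'] --> l -> is_derive t 1 f l.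
Proof.
move=> h; have e : h^-1 *: (f (h *: 1 + t) - f t) @[h --> 0^'] --> l.
  apply: cvg_trans h; apply: near_eq_cvg; near=> h.
  by rewrite [h *: 1]mulr1 (addrC h).
apply: DeriveDef; first by apply/cvg_ex; exists l.
exact: cvg_lim e.
Unshelve. all: by end_near. Qed.

Lemma is_derive_dnbhs_cvg (f : R -> R) (t l : R) :
  is_derive t 1 f l -> h^-1 * (f (t + h) - f t) @[h --> (0 : R)^'] --> l.
Proof.
move=> fl; have <- : 'D_1 f t = l by exact: derive_val.
have : derivable f t 1 by exact: ex_derive.
move=> dft; apply: cvg_trans dft; apply: near_eq_cvg; near=> h.
by rewrite [h *: 1]mulr1 (addrC t).
Unshelve. all: by end_near. Qed.

Lemma lipschitz1 (f df : R -> R) (a b : R) :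
  (forall x : R, is_derive x 1 f (df x)) -> (forall x, `|df x| <= 1) ->
  `|f a - f b| <= `|a - b|.
Proof.
move=> fdf df1; wlog ab : a b / b <= a => [hw|].
  have [/hw//|/ltW/hw] := leP b a.
  by rewrite distrC (distrC a).
have cf : {within `[b, a], continuous f}.
  apply: continuous_subspaceT => s.
  by apply/differentiable_continuous/derivable1_diffP; exact: ex_derive.
have [c _ ->] := MVT_segment ab (fun x _ => fdf x) cf.
by rewrite normrM ler_piMl.
Qed.

Lemma is_derive_sumR (k : nat) (f : 'I_k -> R -> R) (l : 'I_k -> R) (t : R) :
  (forall i, is_derive t 1 (f i) (l i)) ->
  is_derive t 1 (fun s => \sum_i f i s) (\sum_i l i).
Proof.
move=> fl; have -> : (fun s => \sum_i f i s) = \sum_i f i.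
  by apply/funext => s; rewrite fct_sumE.
exact: is_derive_sum.
Qed.

Lemma is_derive_half_sqr (f g : R -> R) (c df dg t : R) :
  is_derive t 1 f df -> is_derive t 1 g dg ->
  is_derive t 1 (fun s => c / 2 * (f s - g s) ^+ 2) (c * (f t - g t) * (df - dg)).
Proof.
move=> fd gd.
have := is_deriveZ (c / 2) (is_deriveX 2 (is_deriveB fd gd)).
have -> : (c / 2) \*: (f - g) ^+ 2 = (fun s => c / 2 * (f s - g s) ^+ 2).
  by apply/funext => s.
move=> h; apply: is_derive_eq h _.
by rewrite /GRing.scale/= expr1 [(f - g) t](_ : _ = f t - g t)//; field.
Qed.

(** The function (f + K) exp(-t) is nonincreasing and (f + K) exp(t) is nondecreasing;
    the first serves positive times, the second negative ones. *)
Lemma gronwall_abs (f df : R -> R) (K : R) :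
  (forall t : R, is_derive t 1 f (df t)) -> (forall t, `|df t| <= f t + K) ->
  forall t, f t + K <= (f 0 + K) * expR `|t|.
Proof.
move=> fd fK.
pose g (s t : R) := (f t + K) * expR (s * t).
have dg (s t : R) : is_derive t 1 (g s) ((df t + s * (f t + K)) * expR (s * t)).
  have ds : is_derive t 1 (fun r : R => s * r) s.
    by have := is_deriveZ s (is_derive_id t 1); rewrite [s *: 1]mulr1.
  have de : is_derive t 1 (fun r : R => expR (s * r)) (expR (s * t) * s).
    exact: is_derive1_comp.
  have dk : is_derive t 1 (fun r => f r + K) (df t).
    by have := is_deriveD (fd t) (is_derive_cst K t 1); rewrite addr0.
  have := is_deriveM dk de.
  move=> h; apply: is_derive_eq h _; rewrite /GRing.scale /=; ring.
have cg s a b : {within `[a, b], continuous g s}.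
  apply: continuous_subspaceT => r.
  by apply/differentiable_continuous/derivable1_diffP; exact: ex_derive.
have g0 s : g s 0 = f 0 + K by rewrite /g mulr0 expR0 mulr1.
move=> t; have [t0|t0] := leP 0 t.
  rewrite ger0_norm//.
  have [c _ E] := MVT_segment t0 (fun r _ => dg (-1) r) (@cg _ _ _).
  have : g (-1) t <= g (-1) 0.
    rewrite -subr_le0 E subr0 mulr_le0_ge0// mulr_le0_ge0 ?expR_ge0//.
    by rewrite mulN1r subr_le0 (le_trans (ler_norm _)).
  by rewrite g0 /g mulN1r expRN ler_pdivrMr// expR_gt0.
rewrite ltr0_norm//.
have [c _ E] := MVT_segment (ltW t0) (fun r _ => dg 1 r) (@cg _ _ _).
have : g 1 t <= g 1 0.
  rewrite -subr_ge0 E sub0r mulr_ge0 ?oppr_ge0 ?(ltW t0)// mulr_ge0 ?expR_ge0//.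
  by rewrite mul1r; have := fK c; rewrite ler_norml => /andP[h _]; lra.
by rewrite g0 /g mul1r expRN ler_pdivlMr ?expR_gt0.
Qed.

End line.

(** * The chain rule for functions of class C1 *)

Section chain_rule.
Context (R : realType) (m n : nat).
Notation M := 'M[R]_(m, n).

Lemma is_derive_line (V : M -> R) (x e : M) (s : R) : derivable V (x + s *: e) e ->
  is_derive s 1 (fun r => V (x + r *: e)) ('D_e V (x + s *: e)).
Proof.
move=> dV.
have E : (fun h : R => h^-1 *: (V (x + (h *: 1 + s) *: e) - V (x + s *: e))) =
         (fun h : R => h^-1 *: (V (h *: e + (x + s *: e)) - V (x + s *: e))).
  by apply/funext => h; rewrite [h *: 1]mulr1 scalerDl addrCA.
by apply: DeriveDef; rewrite /derivable /derive /= E.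
Qed.

(** Turns a derivative computed along a line, hence along a curve, into the directional
    derivative by which the gradient is defined. *)
Lemma derive_line (V : M -> R) (x e : M) (l : R) :
  is_derive (0 : R) 1 (fun r => V (x + r *: e)) l -> 'D_e V x = l.
Proof.
move=> dV; rewrite -[RHS](@derive_val _ _ _ _ _ _ _ dV) /derive.
suff -> : (fun h : R => h^-1 *: (V (x + (h *: 1 + 0) *: e) - V (x + 0 *: e))) =
          (fun h : R => h^-1 *: (V (h *: e + x) - V x)) by [].
by apply/funext => h; rewrite scale0r addr0 [h *: 1]mulr1 addr0 (addrC x).
Qed.

Lemma mvt_line (V : M -> R) (x e : M) (c : R) : (forall y, derivable V y e) ->
  exists2 s, `|s| <= `|c| & V (x + c *: e) - V x = c * 'D_e V (x + s *: e).
Proof.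
move=> dV; pose f (r : R) := V (x + r *: e).
have df (s : R) : is_derive s 1 f ('D_e V (x + s *: e)) by exact: is_derive_line.
have cf a b : {within `[a, b], continuous f}.
  apply: continuous_subspaceT => s.
  by apply/differentiable_continuous/derivable1_diffP; exact: ex_derive.
have f0 : f 0 = V x by rewrite /f scale0r addr0.
have [c0|c0] := leP 0 c.
  have [s sc E] := MVT_segment c0 (fun s _ => df s) (@cf _ _).
  exists s; last by rewrite -f0 -/(f c) E subr0 mulrC.
  by move: sc; rewrite in_itv/= => /andP[s0 sc]; rewrite !ger0_norm.
have [s sc E] := MVT_segment (ltW c0) (fun s _ => df s) (@cf _ _).
exists s; last by rewrite -f0 -/(f c) -[LHS]opprB E sub0r mulrN opprK mulrC.
by move: sc; rewrite in_itv/= => /andP[sc s0]; rewrite !ler0_norm ?lerN2// ltW.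
Qed.

(** The displacement is split into moves parallel to the axes, and each move is treated
    by the mean value theorem. The base point is allowed to depend on the increment, so
    that the induction on the list of axes goes through. *)
Lemma chain_rule_sum (V : M -> R) (x : M) (y : 'I_m * 'I_n -> R)
    (c : 'I_m * 'I_n -> R -> R) (s : seq ('I_m * 'I_n)) (b : R -> M) :
  class_C1 V ->
  (forall e, h^-1 * c e h @[h --> 0^'] --> y e) ->
  b h @[h --> 0^'] --> x ->
  h^-1 * (V (b h + \sum_(e <- s) c e h *: delta_mx e.1 e.2) - V (b h))
    @[h --> 0^'] --> \sum_(e <- s) y e * partial e.1 e.2 V x.
Proof.
move=> [_ V1] cy; elim: s b => [|e s IH] b bx.
  under eq_fun do rewrite big_nil addr0 subrr mulr0.
  by rewrite big_nil; exact: cvg_cst.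
have [dV cV] := V1 e.1 e.2.
pose D := delta_mx e.1 e.2 : M.
have c0 := cvg_dnbhs_diffquot (cy e).
have [r rc rV] : exists2 r : R -> R, forall h, `|r h| <= `|c e h| &
    forall h, V (b h + c e h *: D) - V (b h) = c e h * partial e.1 e.2 V (b h + r h *: D).
  have [r hr] := choice (fun h => let: ex_intro2 s s1 s2 := mvt_line (b h) (c e h) dV in
     ex_intro (fun s => `|s| <= `|c e h| /\
       V (b h + c e h *: D) - V (b h) = c e h * partial e.1 e.2 V (b h + s *: D))
       s (conj s1 s2)).
  by exists r => h; have [] := hr h.
have r0 : r h @[h --> 0^'] --> 0.
  apply/cvgr0Pnorm_lt => eps eps0.
  have /cvgr0Pnorm_lt/(_ _ eps0) := c0.
  by apply: filterS => h; exact: le_lt_trans (rc h).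
have shift (a : R -> R) : a h @[h --> 0^'] --> 0 ->
    b h + a h *: D @[h --> 0^'] --> x.
  move=> a0; rewrite -[X in _ --> X]addr0 -(scale0r D).
  by apply: cvgD => //; exact: cvgZr_tmp.
have -> : (fun h => h^-1 * (V (b h + \sum_(j <- e :: s) c j h *: delta_mx j.1 j.2) - V (b h)))
  = fun h => h^-1 * c e h * partial e.1 e.2 V (b h + r h *: D) +
     h^-1 * (V (b h + c e h *: D + \sum_(j <- s) c j h *: delta_mx j.1 j.2) -
             V (b h + c e h *: D)).
  apply/funext => h; rewrite big_cons -[_ * c e h * _]mulrA -rV -mulrDr addrA.
  by congr (_ * _); ring.
rewrite big_cons; apply: cvgD; last by apply: IH; exact: shift.
by apply: cvgM => //; apply: continuous_cvg; [exact: cV|exact: shift].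
Qed.

Lemma chain_rule (V : M -> R) (q : R -> M) (t : R) (y : M) : class_C1 V ->
  (forall i j, h^-1 * (q (t + h) i j - q t i j) @[h --> 0^'] --> y i j) ->
  is_derive t 1 (V \o q) (\sum_i \sum_j y i j * partial i j V (q t)).
Proof.
move=> V1 qy; apply: is_derive_dnbhs.
have := @chain_rule_sum V (q t) (fun e => y e.1 e.2)
  (fun e h => q (t + h) e.1 e.2 - q t e.1 e.2) (index_enum _) (fun=> q t) V1
  (fun e => qy e.1 e.2) (cvg_cst _).
rewrite pair_bigA /=; set f := (f in f @ _); set g := (g in _ -> g @ _ --> _).
suff -> : f = g by apply.
apply/funext => h; rewrite /f /g; congr (_ * (V _ - _)).
rewrite [X in _ + X](_ : _ = q (t + h) - q t); first by rewrite addrC subrK.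
rewrite [RHS]matrix_sum_delta pair_bigA /=; apply: eq_bigr => e _.
by rewrite !mxE.
Qed.

End chain_rule.

(** * Differential calculus for an inner product *)

Section inner_product.
Context (R : realType) (E : lmodType R).

Record inner_product (B : E -> E -> R) : Prop := InnerProduct {
  innerC : forall x y, B x y = B y x ;
  innerDl : forall x y z, B (x + y) z = B x z + B y z ;
  innerZl : forall a x y, B (a *: x) y = a * B x y ;
  inner_ge0 : forall x, 0 <= B x x }.

Context (B : E -> E -> R) (ipB : inner_product B).

Let BC := innerC ipB.
Let BDl := innerDl ipB.
Let BZl := innerZl ipB.
Let B_ge0 := inner_ge0 ipB.

Lemma innerDr x y z : B x (y + z) = B x y + B x z.
Proof. by rewrite BC BDl !(BC _ x). Qed.

Lemma innerZr a x y : B x (a *: y) = a * B x y.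
Proof. by rewrite BC BZl BC. Qed.

Lemma innerNl x y : B (- x) y = - B x y.
Proof. by rewrite -scaleN1r BZl mulN1r. Qed.

Lemma innerNr x y : B x (- y) = - B x y.
Proof. by rewrite BC innerNl BC. Qed.

Lemma innerBl x y z : B (x - y) z = B x z - B y z.
Proof. by rewrite BDl innerNl. Qed.

Lemma innerBr x y z : B x (y - z) = B x y - B x z.
Proof. by rewrite innerDr innerNr. Qed.

Lemma inner0l x : B 0 x = 0.
Proof. by rewrite -(scale0r 0) BZl mul0r. Qed.

Lemma inner_suml I (r : seq I) (P : pred I) (f : I -> E) x :
  B (\sum_(i <- r | P i) f i) x = \sum_(i <- r | P i) B (f i) x.
Proof.
by elim/big_ind2 : _ => [|a b c e <- <-|//]; rewrite ?inner0l ?BDl.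
Qed.

(** The form is only assumed nonnegative, so B y y = 0 does not give y = 0: in that case
    the affine function B x x - 2 s B x y of s is nonnegative everywhere, hence constant. *)
Lemma inner_CS x y : B x y ^+ 2 <= B x x * B y y.
Proof.
have H s : 0 <= B x x - 2 * s * B x y + s ^+ 2 * B y y.
  have := B_ge0 (x - s *: y).
  rewrite innerBl !innerBr !innerZr !BZl (BC y x).
  suff -> : B x x - s * B x y - (s * B x y - s * (s * B y y)) =
     B x x - 2 * s * B x y + s ^+ 2 * B y y by [].
  by ring.
have := B_ge0 y; rewrite le_eqVlt => /orP[/eqP yy0|yy0].
  rewrite -yy0 in H *; rewrite mulr0.
  suff -> : B x y = 0 by rewrite expr0n.
  apply/eqP/negPn/negP => xy0.
  (* This value of s makes the affine function equal to -1. *)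
  have := H ((B x x + 1) / (2 * B x y)).
  rewrite mulr0 addr0.
  have -> : 2 * ((B x x + 1) / (2 * B x y)) * B x y = B x x + 1 by field.
  by lra.
(* The minimum of the quadratic polynomial. *)
have := H (B x y / B y y).
have -> : B x x - 2 * (B x y / B y y) * B x y + (B x y / B y y) ^+ 2 * B y y =
  (B x x * B y y - B x y ^+ 2) / B y y by field; rewrite gt_eqF.
by rewrite pmulr_lge0 ?invr_gt0// subr_ge0.
Qed.

Lemma inner_sqD x y : B (x + y) (x + y) <= 2 * B x x + 2 * B y y.
Proof.
have := B_ge0 (x - y).
rewrite innerBl !innerBr !BDl !innerDr (BC y x); lra.
Qed.

Lemma inner_2le x y : 2 * `|B x y| <= B x x + B y y.
Proof.
have := B_ge0 (x - y); have := B_ge0 (x + y).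
rewrite innerBl !innerBr !BDl !innerDr (BC y x).
by case: (ger0P (B x y)) => _; lra.
Qed.

Section limits.
Context (I : Type) (F : set_system I) {FF : Filter F}.

Lemma inner_cvg0 (f g : I -> E) (M : R) :
  B (f i) (f i) @[i --> F] --> 0 -> (\forall i \near F, B (g i) (g i) <= M) ->
  B (f i) (g i) @[i --> F] --> 0.
Proof.
move=> f0 gM.
have : B (f i) (f i) * (M + 1) @[i --> F] --> 0.
  by rewrite -(mul0r (M + 1)); apply: cvgMr_tmp.
move=> /cvgr0Pnorm_lt h; apply/cvgr0Pnorm_lt => e e0.
have e20 : 0 < e ^+ 2 by rewrite exprn_gt0.
have := h _ e20; apply: filterS2 gM => i gi hi.
rewrite -(@ltr_pXn2r _ 2) ?nnegrE ?normr_ge0 ?(ltW e0)//.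
rewrite real_normK ?num_real//; apply: le_lt_trans (inner_CS _ _) _.
apply: le_lt_trans hi; rewrite ger0_norm; last first.
  apply: mulr_ge0 => //; apply: le_trans (B_ge0 (g i)) _; lra.
by apply: ler_wpM2l => //; lra.
Qed.

Lemma inner_cvg (f g : I -> E) x y :
  B (f i - x) (f i - x) @[i --> F] --> 0 ->
  B (g i - y) (g i - y) @[i --> F] --> 0 ->
  B (f i) (g i) @[i --> F] --> B x y.
Proof.
move=> fx gy.
have -> : (fun i => B (f i) (g i)) =
  (fun i => B (f i - x) (g i - y) + B (f i - x) y + B (g i - y) x + B x y).
  apply/funext => i; rewrite !innerBl !innerBr !(BC y x) (BC (g i) x); lra.
rewrite -[X in _ --> X]add0r; apply: cvgD; last exact: cvg_cst.
rewrite -[0]addr0; apply: cvgD; last first.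
  by apply: (@inner_cvg0 _ (fun=> x) (B x x)) => //; near=> i.
rewrite -[0]addr0; apply: cvgD; last first.
  by apply: (@inner_cvg0 _ (fun=> y) (B y y)) => //; near=> i.
apply: (@inner_cvg0 _ _ 1) => //.
have /cvgr0Pnorm_lt/(_ _ ltr01) := gy.
by apply: filterS => i; rewrite ger0_norm// => /ltW.
Unshelve. all: by end_near. Qed.

End limits.

(** Convergence is expressed by the form itself, which need not separate points: square-
    integrable functions are used without passing to classes modulo null sets. *)
Definition inner_derive (f : R -> E) (t : R) (v : E) :=
  let r h := h^-1 *: (f (t + h) - f t) - v in B (r h) (r h) @[h --> 0^'] --> 0.

Lemma inner_derive_cvg f t v : inner_derive f t v ->
  B (f (t + h) - f t) (f (t + h) - f t) @[h --> 0^'] --> 0.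
Proof.
move=> fv; have q : B (h^-1 *: (f (t + h) - f t)) (h^-1 *: (f (t + h) - f t))
   @[h --> 0^'] --> B v v by exact: (inner_cvg fv fv).
have h2 : h ^+ 2 * B (h^-1 *: (f (t + h) - f t)) (h^-1 *: (f (t + h) - f t))
   @[h --> 0^'] --> 0.
  rewrite -[X in _ --> X](mul0r (B v v)); apply: cvgM => //.
  by rewrite -[X in _ --> X](mulr0 0); apply: cvgM; exact: nbhs_dnbhs.
apply: cvg_trans h2; apply: near_eq_cvg.
near=> h; rewrite BZl innerZr; field.
by near: h; exact: nbhs_dnbhs_neq.
Unshelve. all: by end_near. Qed.

Lemma is_derive_inner f g t v w : inner_derive f t v -> inner_derive g t w ->
  is_derive t 1 (fun s => B (f s) (g s)) (B v (g t) + B (f t) w).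
Proof.
move=> fv gw; apply: is_derive_dnbhs.
have -> : (fun h => h^-1 * (B (f (t + h)) (g (t + h)) - B (f t) (g t))) =
    fun h => B (h^-1 *: (f (t + h) - f t)) (g (t + h)) +
             B (f t) (h^-1 *: (g (t + h) - g t)).
  by apply/funext => h; rewrite BZl innerZr innerBl innerBr; ring.
apply: cvgD; first exact: (inner_cvg fv (inner_derive_cvg gw)).
apply: inner_cvg gw; under eq_fun do rewrite subrr inner0l.
exact: cvg_cst.
Qed.

Lemma is_derive_innerl f t v x : inner_derive f t v ->
  is_derive t 1 (fun s => B (f s) x) (B v x).
Proof.
move=> fv; have x0 : inner_derive (fun=> x) t 0.
  rewrite /inner_derive subrr; under eq_fun do rewrite scaler0 subrr inner0l.
  exact: cvg_cst.
by have := is_derive_inner fv x0; rewrite (BC _ 0) inner0l addr0.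
Qed.

(** Replaces the product rule when the first factor f is merely continuous. It applies to
    f = T o g for a symmetric operator T such as the multiplication by the frequency, whose
    values are not controlled by the norm in which g is differentiable: the symmetry moves
    the whole increment onto g. *)
Lemma is_derive_inner_sym f g t w :
  (forall r s, B (f r) (g s) = B (f s) (g r)) ->
  B (f (t + h) - f t) (f (t + h) - f t) @[h --> 0^'] --> 0 ->
  inner_derive g t w ->
  is_derive t 1 (fun s => B (f s) (g s)) (2 * B (f t) w).
Proof.
move=> fg ft gw; apply: is_derive_dnbhs.
have -> : (fun h => h^-1 * (B (f (t + h)) (g (t + h)) - B (f t) (g t))) =
    fun h => B (f (t + h)) (h^-1 *: (g (t + h) - g t)) +
             B (f t) (h^-1 *: (g (t + h) - g t)).
  apply/funext => h; rewrite !innerZr !innerBr (fg (t + h) t); ring.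
rewrite mulr2n mulrDl mul1r; apply: cvgD; first exact: (inner_cvg ft gw).
apply: inner_cvg gw; under eq_fun do rewrite subrr inner0l.
exact: cvg_cst.
Qed.

End inner_product.

Section frobenius.
Context (R : realType) (m n : nat).
Implicit Types A : 'M[R]_(m, n).

Definition frob A B : R := \sum_i \sum_j A i j * B i j.

Lemma frob_inner : inner_product frob.
Proof.
split=> [x y|x y z|a x y|x]; rewrite /frob.
- by apply: eq_bigr => i _; apply: eq_bigr => j _; rewrite mulrC.
- rewrite -big_split; apply: eq_bigr => i _ /=; rewrite -big_split.
  by apply: eq_bigr => j _; rewrite mxE mulrDl.
- rewrite mulr_sumr; apply: eq_bigr => i _; rewrite mulr_sumr.
  by apply: eq_bigr => j _; rewrite mxE mulrA.
- by apply: sumr_ge0 => i _; apply: sumr_ge0 => j _; rewrite -expr2 sqr_ge0.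
Qed.

Lemma sqnormE A : sqnorm A = frob A A.
Proof. by apply: eq_bigr => i _; apply: eq_bigr => j _; rewrite expr2. Qed.

Lemma sqnorm_ge0 A : 0 <= sqnorm A.
Proof. by rewrite sqnormE; exact: inner_ge0 frob_inner _. Qed.

Lemma sqnormZ a A : sqnorm (a *: A) = a ^+ 2 * sqnorm A.
Proof.
by rewrite !sqnormE (innerZl frob_inner) (innerZr frob_inner) mulrA.
Qed.

Lemma sqr_entry_le A i j : A i j ^+ 2 <= sqnorm A.
Proof.
rewrite /sqnorm (bigD1 i)//= (bigD1 j)//= -addrA lerDl addr_ge0//.
  by apply: sumr_ge0 => ? _; exact: sqr_ge0.
by apply: sumr_ge0 => ? _; apply: sumr_ge0 => ? _; exact: sqr_ge0.
Qed.

Lemma enorm_sqr A : enorm A ^+ 2 = sqnorm A.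
Proof. by rewrite sqr_sqrtr// sqnorm_ge0. Qed.

Lemma enorm_ge0 A : 0 <= enorm A.
Proof. exact: sqrtr_ge0. Qed.

End frobenius.

(** * Conservation of the energy *)

Section energy_conservation.
Context (R : realType) (E : lmodType R) (B : E -> E -> R) (ipB : inner_product B).
Context (n d : nat) (m : 'I_n -> R) (V : 'M[R]_(n, d) -> R).
Context (g : 'I_n -> 'I_d -> 'rV[R]_d -> E) (dg : 'I_n -> 'I_d -> 'rV[R]_d -> 'rV[R]_d -> E).
Hypothesis V1 : class_C1 V.
Hypothesis g_derive : forall i nu (q : R -> 'rV[R]_d) (t : R) (y : 'rV[R]_d),
  (forall j, h^-1 * (q (t + h) 0 j - q t 0 j) @[h --> (0 : R)^'] --> y 0 j) ->
  inner_derive B (g i nu \o q) t (dg i nu (q t) y).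
Hypothesis dg_linear : forall i nu x y,
  dg i nu x y = \sum_j y 0 j *: dg i nu x (delta_mx 0 j).

Section potential.
Context (P Q : 'M[R]_(n, d)) (a : E).

Definition potential i nu : R := B (g i nu (row i Q)) a.

Definition speed i nu : R := (m i)^-1 * (P i nu - potential i nu).

(** With g the representative of the potential, this is the current of the field equation;
    the factor 1/2 compensates the factor 2 hidden in g. *)
Definition source : E :=
  \sum_i \sum_nu (speed i nu / 2) *: g i nu (row i Q).

Definition kinetic_energy : R :=
  \sum_i \sum_nu (m i)^-1 / 2 * (P i nu - potential i nu) ^+ 2.

End potential.

Context (P Q : R -> 'M[R]_(n, d)) (a w : R -> E) (t : R).
Context (P' Q' : 'M[R]_(n, d)) (v : E).
Hypothesis wa_sym : forall r s, B (w r) (a s) = B (w s) (a r).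
Hypothesis dP : forall i j,
  h^-1 * (P (t + h) i j - P t i j) @[h --> (0 : R)^'] --> P' i j.
Hypothesis dQ : forall i j,
  h^-1 * (Q (t + h) i j - Q t i j) @[h --> (0 : R)^'] --> Q' i j.
Hypothesis da : inner_derive B a t v.
Hypothesis cw : B (w (t + h) - w t) (w (t + h) - w t) @[h --> (0 : R)^'] --> (0 : R).
Hypothesis Q'E : forall i nu, Q' i nu = speed (P t) (Q t) (a t) i nu.
Hypothesis P'E : forall i j, P' i j =
  \sum_nu speed (P t) (Q t) (a t) i nu *
     B (dg i nu (row i (Q t)) (delta_mx 0 j)) (a t) - partial i j V (Q t).
Hypothesis field_eq : B (w t - source (P t) (Q t) (a t)) v = 0.

Let y i nu := speed (P t) (Q t) (a t) i nu.
Let D i nu j := B (dg i nu (row i (Q t)) (delta_mx 0 j)) (a t).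
Let C i nu := B (g i nu (row i (Q t))) v.

Lemma is_derive_potential i nu :
  is_derive t 1 (fun s => potential (Q s) (a s) i nu) (\sum_j y i j * D i nu j + C i nu).
Proof.
have q : forall j, h^-1 * (row i (Q (t + h)) 0 j - row i (Q t) 0 j) @[h --> (0 : R)^'] -->
   (row i Q') 0 j.
  by move=> j; under eq_fun do rewrite !mxE; rewrite mxE; exact: dQ.
have := is_derive_inner ipB (@g_derive i nu (fun s => row i (Q s)) t _ q) da.
rewrite dg_linear (inner_suml ipB) /=.
have -> : \sum_j B ((row i Q') 0 j *: dg i nu (row i (Q t)) (delta_mx 0 j)) (a t) =
  \sum_j y i j * D i nu j.
  by apply: eq_bigr => j _; rewrite (innerZl ipB) mxE Q'E.
by [].
Qed.

(** The magnetic part of the force equals the transport term of the potential after the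
    two coordinate indices are exchanged, and the work of grad V is the derivative of V.
    There remains 2 B (w - source) v, which vanishes because the field equation states that
    w - source is v rotated by a quarter turn. *)
Lemma energy_derive : is_derive t 1
  (fun s => kinetic_energy (P s) (Q s) (a s) + V (Q s) + B (w s) (a s)) 0.
Proof.
have dPr i j : is_derive t 1 (fun s => P s i j) (P' i j).
  exact: (@is_derive_dnbhs _ (fun s => P s i j) _ _ (@dP i j)).
have dK : is_derive t 1 (fun s => kinetic_energy (P s) (Q s) (a s))
   (\sum_i \sum_nu (m i)^-1 * (P t i nu - potential (Q t) (a t) i nu) *
      (P' i nu - (\sum_j y i j * D i nu j + C i nu))).
  apply: is_derive_sumR => i; apply: is_derive_sumR => nu.
  exact: (is_derive_half_sqr _ (dPr i nu) (is_derive_potential i nu)).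
have dV := chain_rule V1 dQ.
have dW := is_derive_inner_sym ipB wa_sym cw da.
(* The equations of motion are inserted only now, in the sum of the three derivatives. *)
have := is_deriveD (is_deriveD dK dV) dW.
move=> h; apply: is_derive_eq h _.
have -> : 2 * B (w t) v = \sum_i \sum_nu y i nu * C i nu.
  have : B (w t) v = B (source (P t) (Q t) (a t)) v.
    by apply/eqP; rewrite -subr_eq0 -(innerBl ipB) field_eq.
  move=> ->; rewrite /source (inner_suml ipB) mulr_sumr; apply: eq_bigr => i _.
  rewrite (inner_suml ipB) mulr_sumr; apply: eq_bigr => nu _.
  by rewrite (innerZl ipB) /y /C; field.
rewrite -!big_split /= big1// => i _.
have -> : \sum_nu (m i)^-1 * (P t i nu - potential (Q t) (a t) i nu) *
      (P' i nu - (\sum_j y i j * D i nu j + C i nu)) =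
  \sum_nu \sum_mu y i nu * (y i mu * D i mu nu) -
  \sum_nu \sum_mu y i nu * (y i mu * D i nu mu)
  - \sum_nu y i nu * partial i nu V (Q t) - \sum_nu y i nu * C i nu.
  rewrite -!sumrB; apply: eq_bigr => nu _; rewrite -!mulr_sumr.
  have -> : P' i nu = \sum_mu y i mu * D i mu nu - partial i nu V (Q t) := P'E i nu.
  rewrite -[(m i)^-1 * _]/(y i nu); ring.
rewrite (exchange_big _ _ _ _ _ (fun nu mu => y i nu * (y i mu * D i nu mu))) /=.
have -> : \sum_nu Q' i nu * partial i nu V (Q t) = \sum_nu y i nu * partial i nu V (Q t).
  by apply: eq_bigr => nu _; rewrite Q'E.
have -> : \sum_j \sum_i0 y i i0 * (y i j * D i i0 j) = \sum_nu \sum_mu y i nu * (y i mu * D i mu nu).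
  by apply: eq_bigr => j _; apply: eq_bigr => k _; ring.
ring.
Qed.

End energy_conservation.

(** * Estimates by the energy *)

Section energy_bounds.
Context (R : realType) (E : lmodType R) (B : E -> E -> R) (ipB : inner_product B).
Context (n d : nat) (m : 'I_n -> R).
Context (g : 'I_n -> 'I_d -> 'rV[R]_d -> E).
Hypothesis m_gt0 : forall i, 0 < m i.

Lemma inner_sum_sq (I : finType) (x : I -> E) :
  B (\sum_i x i) (\sum_i x i) <= #|I|%:R * \sum_i B (x i) (x i).
Proof.
rewrite (inner_suml ipB).
apply: (@le_trans _ _ (\sum_i \sum_j (B (x i) (x i) + B (x j) (x j)) / 2)).
  apply: ler_sum => i _; rewrite (innerC ipB) (inner_suml ipB); apply: ler_sum => j _.
  rewrite (innerC ipB); have := inner_2le ipB (x i) (x j).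
  by have := ler_norm (B (x i) (x j)); lra.
have sc (c : R) : \sum_(j : I) c = #|I|%:R * c by rewrite sumr_const mulr_natl.
under eq_bigr do rewrite -mulr_suml big_split /= sc.
by rewrite -mulr_suml big_split /= sc -mulr_sumr; lra.
Qed.

Let total_mass : R := \sum_i m i.
Let total_inv : R := \sum_i (m i)^-1.

Let minv_ge0 i : 0 <= (m i)^-1.
Proof. by rewrite invr_ge0 ltW. Qed.

Let total_inv_ge0 : 0 <= total_inv.
Proof. exact: sumr_ge0. Qed.

Let total_mass_ge0 : 0 <= total_mass.
Proof. by apply: sumr_ge0 => i _; exact: ltW. Qed.

Let mass_le i : m i <= total_mass.
Proof.
by rewrite /total_mass (bigD1 i)//= lerDl sumr_ge0// => j _; exact: ltW.
Qed.

Let inv_le i : (m i)^-1 <= total_inv.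
Proof. by rewrite /total_inv (bigD1 i)//= lerDl sumr_ge0. Qed.

Section state.
Context (P Q : 'M[R]_(n, d)) (a : E) (kappa gam T : R).
Hypothesis T_ge0 : 0 <= T.
Hypothesis pot_le : forall i nu, potential B g Q a i nu ^+ 2 <= kappa * T.
Hypothesis g_le : forall i nu x, B (g i nu x) (g i nu x) <= gam.
Hypothesis gamma_ge0 : 0 <= gam.

Notation pot := (potential B g Q a).
Notation S := (\sum_i \sum_nu (P i nu - pot i nu) ^+ 2).
Notation K := (kinetic_energy B m g P Q a).

Lemma kinetic_ge0 : 0 <= K.
Proof.
by apply: sumr_ge0 => i _; apply: sumr_ge0 => j _; rewrite mulr_ge0 ?sqr_ge0// divr_ge0.
Qed.

Lemma mechanical_le : S <= 2 * total_mass * K.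
Proof.
rewrite mulr_sumr; apply: ler_sum => i _; rewrite mulr_sumr; apply: ler_sum => nu _.
have -> : 2 * total_mass * ((m i)^-1 / 2 * (P i nu - pot i nu) ^+ 2) =
   (total_mass / m i) * (P i nu - pot i nu) ^+ 2 by field; rewrite gt_eqF.
by rewrite ler_peMl ?sqr_ge0// ler_pdivlMr// mul1r.
Qed.

Lemma kinetic_le : K <= total_inv / 2 * S.
Proof.
rewrite mulr_sumr; apply: ler_sum => i _; rewrite mulr_sumr; apply: ler_sum => nu _.
by rewrite ler_wpM2r ?sqr_ge0// ler_pM2r// invr_gt0.
Qed.

Let sum_pot : \sum_i \sum_nu pot i nu ^+ 2 <= n%:R * d%:R * kappa * T.
Proof.
apply: (@le_trans _ _ (\sum_(i < n) \sum_(nu < d) kappa * T)).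
  by apply: ler_sum => i _; apply: ler_sum => nu _.
by under eq_bigr do rewrite sumr_const card_ord -mulr_natl;
   rewrite sumr_const card_ord -[leLHS]mulr_natl !mulrA.
Qed.

Lemma momentum_le : sqnorm P <= 2 * S + 2 * (n%:R * d%:R * kappa * T).
Proof.
apply: (@le_trans _ _ (2 * S + 2 * \sum_i \sum_nu pot i nu ^+ 2)); last first.
  by rewrite lerD2l ler_pM2l.
rewrite !mulr_sumr -big_split; apply: ler_sum => i _ /=.
rewrite !mulr_sumr -big_split; apply: ler_sum => nu _ /=.
by have := sqr_ge0 (P i nu - 2 * pot i nu); nra.
Qed.

Lemma mechanical_le_momentum : S <= 2 * sqnorm P + 2 * (n%:R * d%:R * kappa * T).
Proof.
apply: (@le_trans _ _ (2 * sqnorm P + 2 * \sum_i \sum_nu pot i nu ^+ 2)); last first.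
  by rewrite lerD2l ler_pM2l.
rewrite !mulr_sumr -big_split; apply: ler_sum => i _ /=.
rewrite !mulr_sumr -big_split; apply: ler_sum => nu _ /=.
by have := sqr_ge0 (P i nu + pot i nu); nra.
Qed.

Lemma source_le : B (source B m g P Q a) (source B m g P Q a) <=
  n%:R * d%:R * gam * total_inv ^+ 2 * S.
Proof.
apply: le_trans (inner_sum_sq _) _; rewrite card_ord -!mulrA ler_wpM2l//.
rewrite !mulr_sumr; apply: ler_sum => i _.
apply: le_trans (inner_sum_sq _) _; rewrite card_ord ler_wpM2l//.
rewrite !mulr_sumr; apply: ler_sum => nu _.
rewrite (innerZl ipB) (innerZr ipB) /speed.
have -> : (m i)^-1 * (P i nu - pot i nu) / 2 *
   ((m i)^-1 * (P i nu - pot i nu) / 2 * B (g i nu (row i Q)) (g i nu (row i Q))) =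
   B (g i nu (row i Q)) (g i nu (row i Q)) * ((m i)^-1 ^+ 2 * ((P i nu - pot i nu) ^+ 2)) / 4.
  by move: (m i)^-1 => r; field.
have h1 : (m i)^-1 ^+ 2 <= total_inv ^+ 2 by rewrite lerXn2r ?nnegrE.
have h2 := g_le i nu (row i Q).
have h3 : 0 <= (m i)^-1 ^+ 2 * (P i nu - pot i nu) ^+ 2 by rewrite mulr_ge0 ?sqr_ge0.
apply: (@le_trans _ _ (gam * ((m i)^-1 ^+ 2 * (P i nu - pot i nu) ^+ 2))).
  have := ler_wpM2r h3 h2; have := mulr_ge0 (inner_ge0 ipB (g i nu (row i Q))) h3; lra.
by rewrite ler_wpM2l// [leRHS]mulrA ler_wpM2r ?sqr_ge0.
Qed.

End state.

(** Since V is bounded, the energy controls the kinetic and the field part separately; the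
    momentum is then recovered from p = m q' + A, where A is controlled by the field part.
    Conversely the same inequality bounds the energy by the momentum and the field part. *)
Lemma energy_bounds (kappa gam M : R) : 0 <= kappa -> 0 <= gam -> 0 <= M ->
  (forall i nu x, B (g i nu x) (g i nu x) <= gam) ->
  exists2 C, 0 <= C & forall P Q a T W, 0 <= T -> `|W| <= M ->
    (forall i nu, potential B g Q a i nu ^+ 2 <= kappa * T) ->
    let H := kinetic_energy B m g P Q a + W + T in
    [/\ sqnorm P + T <= C * (H + M),
        H + M <= C * (1 + (sqnorm P + T)) &
        B (source B m g P Q a) (source B m g P Q a) <= C * (H + M)].
Proof.
move=> k0 gam0 M0 gg.
pose N : R := n%:R * d%:R * kappa.
have N0 : 0 <= N by rewrite /N; do !apply: mulr_ge0.
pose C1 := 4 * total_mass + 2 * N + 1.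
pose C2 := total_inv + total_inv * N + 1 + 2 * M.
pose C3 := n%:R * d%:R * gam * total_inv ^+ 2 * (2 * total_mass).
have C10 : 0 <= C1 by have := total_mass_ge0; rewrite /C1; lra.
have C20 : 0 <= C2 by have := mulr_ge0 total_inv_ge0 N0; have := total_inv_ge0; rewrite /C2; lra.
have C30 : 0 <= C3 by rewrite /C3; do !apply: mulr_ge0 => //; exact: sqr_ge0.
exists (C1 + C2 + C3); first by rewrite addr_ge0// addr_ge0.
move=> P Q a T W T0 WM pT H.
have WM1 : - M <= W <= M by rewrite -ler_norml.
have K0 := kinetic_ge0 P Q a.
have HM0 : 0 <= H + M by rewrite /H; case/andP: WM1 => ? ?; lra.
have TH : T <= H + M by rewrite /H; case/andP: WM1 => ? ?; lra.
have KH : kinetic_energy B m g P Q a <= H + M by rewrite /H; case/andP: WM1 => ? ?; lra.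
have SK := mechanical_le P Q a.
have SK2 := ler_wpM2l total_mass_ge0 KH.
have D0 : 0 <= 1 + (sqnorm P + T) by have := sqnorm_ge0 P; lra.
have up C x : 0 <= x -> C <= C1 + C2 + C3 -> C * x <= (C1 + C2 + C3) * x.
  by move=> x0 h; exact: ler_wpM2r.
split.
- apply: le_trans (up C1 _ HM0 _); last by lra.
  have := momentum_le P pT; rewrite -/N.
  have := ler_wpM2l N0 TH; rewrite /C1; lra.
- apply: le_trans (up C2 _ D0 _); last by lra.
  have h1 := kinetic_le P Q a.
  have h2 := ler_wpM2l total_inv_ge0 (mechanical_le_momentum P pT).
  rewrite -/N in h2.
  have P0 := sqnorm_ge0 P.
  have := mulr_ge0 total_inv_ge0 T0; have := mulr_ge0 total_inv_ge0 N0.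
  have := mulr_ge0 M0 T0; have := mulr_ge0 M0 P0.
  have := mulr_ge0 (mulr_ge0 total_inv_ge0 N0) P0.
  have := total_inv_ge0.
  by rewrite /H /C2; case/andP: WM1 => ? ?; lra.
apply: le_trans (up C3 _ HM0 _); last by lra.
apply: le_trans (source_le P Q a gg gam0) _; rewrite /C3 -[leRHS]mulrA.
apply: ler_wpM2l; first by do !apply: mulr_ge0 => //; exact: sqr_ge0.
by lra.
Qed.

End energy_bounds.

(** * Square-integrable fields *)

Section square_integrable_fields.
Context d (T : measurableType d) (R : realType) (mu : {measure set T -> \bar R}).
Context (m n : nat).
Implicit Types f g : T -> 'M[R]_(m, n).

Definition L2pred : {pred T -> 'M[R]_(m, n)} := fun f =>
  `[< (forall i j, measurable_fun setT (fun x => f x i j)) /\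
      (\int[mu]_x (sqnorm (f x))%:E < +oo)%E >].

Lemma measurable_frob f g :
  (forall i j, measurable_fun setT (fun x => f x i j)) ->
  (forall i j, measurable_fun setT (fun x => g x i j)) ->
  measurable_fun setT (fun x => frob (f x) (g x)).
Proof.
move=> mf mg; apply: measurable_sum => i; apply: measurable_sum => j.
exact: measurable_funM.
Qed.

Lemma L2pred_integrable f : f \in L2pred ->
  mu.-integrable setT (fun x => (sqnorm (f x))%:E).
Proof.
move=> /asboolP[mf fi]; apply/integrableP; split.
  by apply/measurable_EFinP; under eq_fun do rewrite sqnormE; exact: measurable_frob.
by under eq_integral do rewrite gee0_abs ?lee_fin ?sqnorm_ge0//.
Qed.

Lemma L2pred_dominated f (G : T -> R) :
  (forall i j, measurable_fun setT (fun x => f x i j)) ->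
  mu.-integrable setT (EFin \o G) ->
  {ae mu, forall x, sqnorm (f x) <= G x} -> f \in L2pred.
Proof.
move=> mf iG fG; apply/asboolP; split=> //.
have mff : measurable_fun setT (fun x => (sqnorm (f x))%:E).
  by apply/measurable_EFinP; under eq_fun do rewrite sqnormE; exact: measurable_frob.
have : (\int[mu]_x `|(G x)%:E| < +oo)%E by have /integrableP[] := iG.
apply: le_lt_trans; apply: ae_ge0_le_integral => //.
- by move=> x _; rewrite lee_fin sqnorm_ge0.
- by apply: measurableT_comp => //; have /integrableP[] := iG.
- by apply: filterS fG => x fx _; rewrite lee_fin (le_trans fx)// ler_norm.
Qed.

Lemma L2pred_submod : submod_closed L2pred.
Proof.
split=> [|a f g Pf Pg].
  apply/asboolP; split=> [i j|].
    by rewrite (_ : (fun x => _) = cst 0)//; apply/funext => x; rewrite mxE.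
  rewrite (_ : (fun x => _) = cst 0%E) ?integral_cst ?mul0e//.
  by apply/funext => x; rewrite sqnormE (inner0l (@frob_inner R m n)).
have /asboolP[mf fi] := Pf; have /asboolP[mg gi] := Pg.
apply: (@L2pred_dominated _ (fun x => 2 * a ^+ 2 * sqnorm (f x) + 2 * sqnorm (g x))).
- move=> i j; rewrite (_ : (fun x => _) = (fun x => a * f x i j + g x i j)); last first.
    by apply/funext => x; rewrite !mxE.
  by apply: measurable_funD => //; exact: measurable_funM.
- rewrite (_ : _ \o _ = fun x => ((2 * a ^+ 2)%:E * (sqnorm (f x))%:E +
    2%:E * (sqnorm (g x))%:E)%E)//.
  by apply: integrableD => //; apply: integrableZl => //; exact: L2pred_integrable.
apply: aeW => x; rewrite -mulrA -sqnormZ !sqnormE.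
exact: inner_sqD (@frob_inner R m n) _ _.
Qed.

HB.instance Definition _ := GRing.isSubmodClosed.Build R (T -> 'M[R]_(m, n))
  L2pred L2pred_submod.

(** Functions rather than classes, so that they can be evaluated; matrices rather than scalars,
    so that one type serves the complex rows of the polarizations. *)
Record L2field := L2Field { L2fun :> T -> 'M[R]_(m, n) ; _ : L2fun \in L2pred }.

HB.instance Definition _ := [isSub for L2fun].
HB.instance Definition _ := [Choice of L2field by <:].
HB.instance Definition _ := [SubChoice_isSubLmodule of L2field by <:].

Implicit Types F G : L2field.

Lemma L2fieldD F G x : (F + G) x = F x + G x.
Proof. by []. Qed.

Lemma L2fieldN F x : (- F) x = - F x.
Proof. by []. Qed.

Lemma L2fieldZ a F x : (a *: F) x = a *: F x.
Proof. by []. Qed.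

Lemma L2field_lin a F G H x : (a *: (F - G) - H) x = a *: (F x - G x) - H x.
Proof. by []. Qed.

Lemma L2field_sum I (r : seq I) (P : pred I) (h : I -> L2field) x :
  (\sum_(i <- r | P i) h i) x = \sum_(i <- r | P i) h i x.
Proof. by elim/big_ind2 : _ => // ? ? ? ? <- <-. Qed.

Lemma L2field_mem F : L2fun F \in L2pred.
Proof. exact: valP. Qed.

Lemma measurable_L2field F i j : measurable_fun setT (fun x => F x i j).
Proof. by have /asboolP[] := L2field_mem F. Qed.

Definition L2inner F G : R := (\int[mu]_x frob (F x) (G x))%R.

Lemma integrable_frob F G :
  mu.-integrable setT (fun x => (frob (F x) (G x))%:E).
Proof.
have iF := L2pred_integrable (L2field_mem F).
have iG := L2pred_integrable (L2field_mem G).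
apply: le_integrable (integrableD _ iF iG) => //.
  by apply/measurable_EFinP; apply: measurable_frob; exact: measurable_L2field.
move=> x _; rewrite /= lee_fin [leRHS]ger0_norm ?addr_ge0 ?sqnorm_ge0// !sqnormE.
have := inner_2le (@frob_inner R m n) (F x) (G x).
have := normr_ge0 (frob (F x) (G x)); lra.
Qed.

(** Entrywise integrability lets the inner product be split into the separate integrals
    over the polarizations by which the vector potential is defined. *)
Lemma integrable_entry F G i j :
  mu.-integrable setT (fun x => (F x i j * G x i j)%:E).
Proof.
have iF := L2pred_integrable (L2field_mem F).
have iG := L2pred_integrable (L2field_mem G).
apply: le_integrable (integrableD _ iF iG) => //.
  by apply/measurable_EFinP; apply: measurable_funM; exact: measurable_L2field.
move=> x _; rewrite /= lee_fin [leRHS]ger0_norm ?addr_ge0 ?sqnorm_ge0//.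
have := sqr_entry_le (F x) i j; have := sqr_entry_le (G x) i j.
have := sqr_ge0 (`|F x i j| - `|G x i j|).
rewrite sqrrB !real_normK ?num_real// normrM.
have : 0 <= `|F x i j| * `|G x i j| by rewrite mulr_ge0.
lra.
Qed.

Lemma L2innerE F G :
  L2inner F G = \sum_i \sum_j (\int[mu]_x (F x i j * G x i j))%R.
Proof.
have RI I (r : seq I) (h : I -> T -> R) :
  (forall i, mu.-integrable setT (EFin \o h i)) ->
  (\int[mu]_x \sum_(i <- r) h i x)%R = \sum_(i <- r) (\int[mu]_x h i x)%R /\
  mu.-integrable setT (fun x => (\sum_(i <- r) h i x)%:E).
  move=> ih; elim: r => [|i r [IH1 IH2]].
    under eq_Rintegral do rewrite big_nil.
    rewrite big_nil Rintegral_cst// mul0r; split=> //.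
    by under eq_fun do rewrite big_nil; exact: integrable0.
  under eq_Rintegral do rewrite big_cons.
  rewrite big_cons RintegralD// IH1; split=> //.
  under eq_fun do rewrite big_cons EFinD.
  by apply: (@integrableD _ _ _ mu _ _ (EFin \o h i)).
rewrite /L2inner /frob.
have ie i j := integrable_entry F G i j.
have RIi i := RI _ (index_enum 'I_n) (fun j x => F x i j * G x i j) (ie i).
rewrite (RI _ (index_enum 'I_m) (fun i x => \sum_j F x i j * G x i j) (fun i => (RIi i).2)).1.
by apply: eq_bigr => i _; rewrite (RIi i).1.
Qed.

Lemma L2inner_inner : inner_product L2inner.
Proof.
have ip := @frob_inner R m n.
split=> [F G|F G H|a F G|F]; rewrite /L2inner.
- by apply: eq_Rintegral => x _; rewrite (innerC ip).
- under eq_Rintegral do rewrite L2fieldD (innerDl ip).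
  by apply: RintegralD => //; exact: integrable_frob.
- under eq_Rintegral do rewrite L2fieldZ (innerZl ip).
  by apply: RintegralZl => //; exact: integrable_frob.
- by apply: Rintegral_ge0 => x _; exact: inner_ge0 ip _.
Qed.

Lemma L2inner_sqE F : ((L2inner F F)%:E = \int[mu]_x (sqnorm (F x))%:E)%E.
Proof.
rewrite /L2inner /Rintegral fineK; first by under [RHS]eq_integral do rewrite sqnormE.
exact: integrable_fin_num (integrable_frob F F).
Qed.

Lemma ae_eq_L2inner F G F' G' :
  {ae mu, forall x, frob (F x) (G x) = frob (F' x) (G' x)} ->
  L2inner F G = L2inner F' G'.
Proof.
move=> h; rewrite /L2inner /Rintegral; congr fine; apply: ae_eq_integral => //.
- by have /integrableP[] := integrable_frob F G.
- by have /integrableP[] := integrable_frob F' G'.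
- by apply: filterS h => x -> _.
Qed.

End square_integrable_fields.

Section L2_dominated_convergence.
Context d (T : measurableType d) (R : realType) (mu : {measure set T -> \bar R}).
Context (m n : nat).

Lemma L2_dominated (f : R -> L2field mu m n) (G : T -> R) :
  mu.-integrable setT (EFin \o G) ->
  (\forall h \near 0^', forall x, sqnorm (f h x) <= G x) ->
  (forall x, sqnorm (f h x) @[h --> 0^'] --> 0) ->
  L2inner (f h) (f h) @[h --> 0^'] --> 0.
Proof.
move=> iG fG f0; apply/cvgr_dnbhsP => u [u_neq0 u0].
have fx0 x : sqnorm (f (u k) x) @[k --> \oo] --> 0.
  by have /cvgr_dnbhsP := f0 x; apply.
have /= [N _ HN] : \forall k \near \oo, forall x, sqnorm (f (u k) x) <= G x.
  (* A sequence that avoids 0 and tends to 0 eventually satisfies the domination. *)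
  have ud : u k @[k --> \oo] --> 0^'.
    move=> A A0; have : \forall k \near \oo, u k != 0 -> A (u k) by exact: u0 A0.
    by apply: filterS => k; apply; exact: u_neq0.
  exact: (ud _ fG).
rewrite -(cvg_shiftn N).
rewrite (_ : [sequence _]_k = fine \o
    (fun k => \int[mu]_x (sqnorm (f (u (k + N)%N) x))%:E)%E); last first.
  by apply/funext => k /=; rewrite -L2inner_sqE.
apply: fine_cvg.
have [] := @dominated_convergence _ T R mu setT measurableT
  (fun k x => (sqnorm (f (u (k + N)%N) x))%:E) (cst 0%E) (EFin \o G).
- by move=> k; have /integrableP[] := L2pred_integrable (L2field_mem (f (u (k + N)%N))).
- exact: measurable_cst.
- apply: aeW => x _; apply: cvg_EFin; first by near=> k.
  by have := fx0 x; rewrite -(cvg_shiftn N).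
- exact: iG.
- apply: aeW => x k _; rewrite gee0_abs ?lee_fin ?sqnorm_ge0//; apply: HN.
  by rewrite /= leq_addl.
by move=> _ _; rewrite integral0.
Unshelve. all: by end_near. Qed.

End L2_dominated_convergence.

(** * Complex fields *)

Section complex_rows.
Context (R : realType).

Section row.
Context (N : nat).
Implicit Types z w : 'rV[R[i]]_N.

(** Complex rows as real matrices: the inner product that matters here is the real part of the
    hermitian one, since only real multiples of fields and real derivatives in time occur. *)
Definition realify z : 'M[R]_(2, N) :=
  \matrix_(b, l) (if b == 0 then complex.Re (z 0 l) else complex.Im (z 0 l)).

Lemma frob_realify z w : frob (realify z) (realify w) =
  \sum_l (complex.Re (z 0 l) * complex.Re (w 0 l) +
          complex.Im (z 0 l) * complex.Im (w 0 l)).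
Proof.
rewrite /frob big_ord_recl big_ord1 -big_split /=.
by apply: eq_bigr => l _; rewrite !mxE.
Qed.

Lemma sqnorm_realify z : sqnorm (realify z) = csqnorm z.
Proof.
by rewrite sqnormE frob_realify; apply: eq_bigr => l _; rewrite /sqmod !expr2.
Qed.

Lemma realifyD z w : realify (z + w) = realify z + realify w.
Proof. by apply/matrixP => b l; rewrite !mxE; case: ifP => _; case: (z 0 l) (w 0 l) => ? ? []. Qed.

Lemma realifyN z : realify (- z) = - realify z.
Proof. by apply/matrixP => b l; rewrite !mxE; case: ifP => _; case: (z 0 l). Qed.

Lemma realifyB z w : realify (z - w) = realify z - realify w.
Proof. by rewrite realifyD realifyN. Qed.

Lemma realifyZ (a : R) z : realify (a%:C *: z) = a *: realify z.
Proof.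
apply/matrixP => b l; rewrite !mxE; case: (z 0 l) => x y /=.
by case: ifP => _; ring.
Qed.

(** Multiplication by i is a quarter turn: this is why the field equation produces no net
    energy, and why the free evolution preserves the L2 norm. *)
Lemma frob_realify_i z : frob (realify ('i *: z)) (realify z) = 0.
Proof.
rewrite frob_realify big1// => l _; rewrite !mxE; case: (z 0 l) => x y /=; ring.
Qed.

Lemma frob_realify_ii z w :
  frob (realify ('i *: z)) (realify ('i *: w)) = frob (realify z) (realify w).
Proof.
rewrite !frob_realify; apply: eq_bigr => l _; rewrite !mxE.
by case: (z 0 l) (w 0 l) => x y [x' y'] /=; ring.
Qed.

Lemma csqnormZ c z : csqnorm (c *: z) = sqmod c * csqnorm z.
Proof.
rewrite /csqnorm mulr_sumr; apply: eq_bigr => l _; rewrite !mxE.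
by case: c (z 0 l) => x y [x' y'] /=; rewrite /sqmod /=; ring.
Qed.

Lemma measurable_realify d (T : measurableType d) (f : T -> 'rV[R[i]]_N) :
  measurable_fun setT f ->
  forall b l, measurable_fun setT (fun x => realify (f x) b l).
Proof.
move=> mf b l; have mfl : measurable_fun setT (fun x => f x 0 l).
  by apply: (measurableT_comp (@measurable_coord _ _ _ _ 0 l)).
rewrite (_ : (fun x => _) = (if b == 0 then @complex.Re R else @complex.Im R)
                              \o (fun x => f x 0 l)).
  apply: measurableT_comp mfl.
  by case: ifP => _; [exact: measurable_Re|exact: measurable_Im].
by apply/funext => x; rewrite mxE /=; case: ifP.
Qed.

End row.

Lemma sqmod_ge0 (z : R[i]) : 0 <= sqmod z.
Proof. by rewrite addr_ge0 ?sqr_ge0. Qed.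

Lemma sqmodM (z w : R[i]) : sqmod (z * w) = sqmod z * sqmod w.
Proof. by case: z w => x y [x' y'] /=; rewrite /sqmod /=; ring. Qed.

Lemma sqmodC (a : R) : sqmod a%:C = a ^+ 2.
Proof. by rewrite /sqmod /=; ring. Qed.

Lemma sqmod_expi (x : R) : sqmod (expi x) = 1.
Proof. by rewrite /sqmod /= cos2Dsin2. Qed.

Lemma measurable_complex d (T : measurableType d) (f : T -> R[i]) :
  measurable_fun setT (fun x => complex.Re (f x)) ->
  measurable_fun setT (fun x => complex.Im (f x)) -> measurable_fun setT f.
Proof.
move=> mr mi; apply: (@measurability _ _ _ _ setT f (@complex_cylinder R)) => //.
move=> _ [_ [B mB [->|->]] <-]; [exact: mr|exact: mi].
Qed.

Lemma measurable_complexM d (T : measurableType d) (f g : T -> R[i]) :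
  measurable_fun setT f -> measurable_fun setT g ->
  measurable_fun setT (fun x => f x * g x).
Proof.
move=> mf mg.
have mRf := measurableT_comp (@measurable_Re R) mf.
have mRg := measurableT_comp (@measurable_Re R) mg.
have mIf := measurableT_comp (@measurable_Im R) mf.
have mIg := measurableT_comp (@measurable_Im R) mg.
apply: measurable_complex.
  rewrite (_ : (fun x => _) = (fun x => complex.Re (f x) * complex.Re (g x) -
     complex.Im (f x) * complex.Im (g x))).
    by apply: measurable_funB; exact: measurable_funM.
  by apply/funext => x; case: (f x) (g x) => ? ? [].
rewrite (_ : (fun x => _) = (fun x => complex.Re (f x) * complex.Im (g x) +
     complex.Im (f x) * complex.Re (g x))).
  by apply: measurable_funD; exact: measurable_funM.
by apply/funext => x; case: (f x) (g x) => ? ? [].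
Qed.

Lemma measurable_complexC d (T : measurableType d) (f : T -> R) :
  measurable_fun setT f -> measurable_fun setT (fun x => (f x)%:C).
Proof. by move=> mf; apply: measurable_complex. Qed.

Lemma measurable_expi d (T : measurableType d) (f : T -> R) :
  measurable_fun setT f -> measurable_fun setT (fun x => expi (f x)).
Proof.
move=> mf; apply: measurable_complex => /=.
  apply: (@measurableT_comp _ _ _ _ _ _ (@cos R)) => //.
  by apply: continuous_measurable_fun; exact: continuous_cos.
apply: (@measurableT_comp _ _ _ _ _ _ (@sin R)) => //.
by apply: continuous_measurable_fun; exact: continuous_sin.
Qed.

Lemma measurable_rowB d (T : measurableType d) N (f g : T -> 'rV[R[i]]_N) :
  measurable_fun setT f -> measurable_fun setT g -> measurable_fun setT (fun k => f k - g k).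
Proof.
move=> mf mg.
have mfl (a : T -> 'rV[R[i]]_N) l : measurable_fun setT a ->
    measurable_fun setT (fun k => a k 0 l).
  by move=> ma; apply: (measurableT_comp (@measurable_coord _ _ _ _ 0 l)).
have mR a l ma := measurableT_comp (@measurable_Re R) (@mfl a l ma).
have mI a l ma := measurableT_comp (@measurable_Im R) (@mfl a l ma).
apply: measurable_fun_mx => i0 l; rewrite (ord1 i0); apply: measurable_complex.
  rewrite (_ : (fun k => _) = fun k => complex.Re (f k 0 l) - complex.Re (g k 0 l)).
    by apply: measurable_funB; exact: mR.
  by apply/funext => k; rewrite !mxE; case: (f k 0 l) (g k 0 l) => ? ? [].
rewrite (_ : (fun k => _) = fun k => complex.Im (f k 0 l) - complex.Im (g k 0 l)).
  by apply: measurable_funB; exact: mI.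
by apply/funext => k; rewrite !mxE; case: (f k 0 l) (g k 0 l) => ? ? [].
Qed.

Lemma measurable_rowZ d (T : measurableType d) N (c : R[i]) (f : T -> 'rV[R[i]]_N) :
  measurable_fun setT f -> measurable_fun setT (fun k => c *: f k).
Proof.
move=> mf; apply: measurable_fun_mx => i0 l; rewrite (ord1 i0).
rewrite (_ : (fun k => _) = fun k => c * f k 0 l).
  apply: measurable_complexM => //.
  by apply: (measurableT_comp (@measurable_coord _ _ _ _ 0 l)).
by apply/funext => k; rewrite mxE.
Qed.

End complex_rows.

(** Junk value 0 outside L2, so that fields are built without carrying proofs. *)
HB.lock Definition weighted_field (R : realType) (d N : nat) (w : 'rV[R]_d -> R)
    (a : 'rV[R]_d -> 'rV[R[i]]_N) : L2field (lebesgue_rV R d) 2 N :=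
  insubd 0 (fun k => w k *: realify (a k)).

Section weighted_fields.
Context (R : realType) (d N : nat).
Notation momentum := 'rV[R]_d.
Notation leb := (lebesgue_rV R d).
Implicit Types (w : momentum -> R) (a : momentum -> 'rV[R[i]]_N).

Definition L2_weight w a := [/\ measurable_fun setT w, measurable_fun setT a &
  (\int[leb]_k (w k ^+ 2 * csqnorm (a k))%:E < +oo)%E].

Lemma weighted_fieldE w a : L2_weight w a ->
  forall k, weighted_field w a k = w k *: realify (a k).
Proof.
move=> [mw ma iwa] k; have h : (fun k => w k *: realify (a k)) \in @L2pred _ _ _ leb 2 N.
  apply/asboolP; split=> [i j|].
    rewrite (_ : (fun x => _) = (fun x => w x * realify (a x) i j)).
      by apply: measurable_funM => //; exact: measurable_realify.
    by apply/funext => x; rewrite mxE.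
  by under eq_integral do rewrite sqnormZ sqnorm_realify.
by rewrite weighted_field.unlock -[X in X k]/(\val _) insubdK.
Qed.

Lemma weighted_field_sqE w a : L2_weight w a ->
  ((L2inner (weighted_field w a) (weighted_field w a))%:E =
   \int[leb]_k (w k ^+ 2 * csqnorm (a k))%:E)%E.
Proof.
move=> h; rewrite L2inner_sqE; apply: eq_integral => k _.
by rewrite weighted_fieldE// sqnormZ sqnorm_realify.
Qed.

Lemma measurable_wcsqnorm w a : measurable_fun setT w -> measurable_fun setT a ->
  measurable_fun setT (fun k => (w k * csqnorm (a k))%:E).
Proof.
move=> mw ma; apply/measurable_EFinP; apply: measurable_funM => //.
by apply: measurableT_comp ma; exact: measurable_csqnorm.
Qed.

Lemma L2_weight_dominated w w' a : measurable_fun setT w -> measurable_fun setT w' ->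
  measurable_fun setT a -> (forall k, 0 <= w' k) -> (forall k, w k ^+ 2 <= w' k) ->
  (\int[leb]_k (w' k * csqnorm (a k))%:E < +oo)%E -> L2_weight w a.
Proof.
move=> mw mw' ma w'0 ww' i'; split=> //; apply: le_lt_trans i'.
apply: ge0_le_integral => //.
- by move=> k _; rewrite lee_fin mulr_ge0 ?sqr_ge0 ?csqnorm_ge0.
- by apply: measurable_wcsqnorm => //; exact: measurable_funX.
- exact: measurable_wcsqnorm.
- by move=> k _; rewrite lee_fin ler_wpM2r ?csqnorm_ge0.
Qed.

End weighted_fields.

(** * Plane waves modulated by a form factor *)

Section phases.
Context (R : realType).

Lemma sqr_cos_lip (a b : R) : (cos a - cos b) ^+ 2 <= (a - b) ^+ 2.
Proof.
rewrite -(real_normK (num_real (cos a - cos b))) -(real_normK (num_real (a - b))).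
rewrite lerXn2r ?nnegrE//; apply: (@lipschitz1 R cos (fun x => - sin x)).
by move=> x; rewrite normrN sin_max.
Qed.

Lemma sqr_sin_lip (a b : R) : (sin a - sin b) ^+ 2 <= (a - b) ^+ 2.
Proof.
rewrite -(real_normK (num_real (sin a - sin b))) -(real_normK (num_real (a - b))).
rewrite lerXn2r ?nnegrE//; apply: (@lipschitz1 R sin cos).
exact: cos_max.
Qed.

(** Squared modulus of s (exp(ib) - exp(ia)) - i t exp(ia): the error made when the difference
    quotient of a rotating phase is replaced by its derivative. *)
Definition phase_defect (a b s t : R) : R :=
  (s * (cos b - cos a) + t * sin a) ^+ 2 + (s * (sin b - sin a) - t * cos a) ^+ 2.

(** Sine and cosine are 1-Lipschitz, so the defect is controlled by the increment of the
    phase; this is the domination used to differentiate plane waves. *)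
Lemma phase_defect_le a b s t :
  phase_defect a b s t <= 4 * (s ^+ 2 * (b - a) ^+ 2) + 2 * t ^+ 2.
Proof.
have sqD (x y : R) : (x + y) ^+ 2 <= 2 * x ^+ 2 + 2 * y ^+ 2.
  by have := sqr_ge0 (x - y); rewrite sqrrB sqrrD; lra.
have := sqD (s * (cos b - cos a)) (t * sin a).
have := sqD (s * (sin b - sin a)) (- (t * cos a)).
rewrite sqrrN !exprMn /phase_defect.
have := ler_wpM2l (sqr_ge0 s) (sqr_cos_lip b a).
have := ler_wpM2l (sqr_ge0 s) (sqr_sin_lip b a).
have : t ^+ 2 * cos a ^+ 2 + t ^+ 2 * sin a ^+ 2 = t ^+ 2.
  by rewrite -mulrDr cos2Dsin2 mulr1.
lra.
Qed.

Lemma phase_defect_cvg (f : R -> R) (t l : R) : is_derive t 1 f l ->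
  phase_defect (f t) (f (t + h)) h^-1 l @[h --> (0 : R)^'] --> (0 : R).
Proof.
move=> fl.
have c : is_derive t 1 (cos \o f) (l * - sin (f t)).
  by rewrite mulrC; exact: is_derive1_comp.
have s : is_derive t 1 (sin \o f) (l * cos (f t)).
  by rewrite mulrC; exact: is_derive1_comp.
have {}c := is_derive_dnbhs_cvg c; have {}s := is_derive_dnbhs_cvg s.
rewrite [X in _ --> X](_ : 0 = (l * - sin (f t) + l * sin (f t)) ^+ 2 +
              (l * cos (f t) - l * cos (f t)) ^+ 2); last by ring.
have c' : h^-1 * (cos (f (t + h)) - cos (f t)) + l * sin (f t) @[h --> (0 : R)^'] -->
   l * - sin (f t) + l * sin (f t).
  by apply: cvgD => //; exact: cvg_cst.
have s' : h^-1 * (sin (f (t + h)) - sin (f t)) - l * cos (f t) @[h --> (0 : R)^'] -->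
   l * cos (f t) - l * cos (f t).
  by apply: cvgB => //; exact: cvg_cst.
by apply: cvgD; apply: cvgM.
Qed.

End phases.

Section dotp.
Context (R : realType) (d : nat).
Notation momentum := 'rV[R]_d.

Lemma dotpE (x y : momentum) : dotp x y = frob x y.
Proof. by rewrite /frob big_ord1. Qed.

Lemma dotp_CS (x y : momentum) : dotp x y ^+ 2 <= sqnorm x * sqnorm y.
Proof. by rewrite dotpE !sqnormE; exact: inner_CS (@frob_inner R 1 d) _ _. Qed.

Lemma measurable_dotp (x : momentum) : measurable_fun setT (fun k => dotp k x).
Proof.
apply: measurable_sum => j; apply: measurable_funM => //; exact: measurable_coord.
Qed.

Lemma measurable_sqrt_enorm : measurable_fun setT (fun k : momentum => Num.sqrt (enorm k)).
Proof.
apply: (@measurableT_comp _ _ _ _ _ _ (@Num.sqrt R : R -> R)).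
  by apply: continuous_measurable_fun => x; exact: sqrt_continuous.
exact: measurable_enorm.
Qed.

End dotp.

(** The conjugate exponential makes the real inner product with an amplitude equal to the real
    part of the integral that defines the vector potential. *)
Definition mode (R : realType) (d N : nat) (G : 'rV[R]_d -> 'rV[R[i]]_N)
    (x k : 'rV[R]_d) : 'rV[R[i]]_N := expi (- (2 * pi * dotp k x)) *: G k.

HB.lock Definition coupling (R : realType) (d N : nat) (G : 'rV[R]_d -> 'rV[R[i]]_N)
    (x : 'rV[R]_d) : L2field (lebesgue_rV R d) 2 N :=
  weighted_field (fun=> 1) (mode G x).

HB.lock Definition dcoupling (R : realType) (d N : nat) (G : 'rV[R]_d -> 'rV[R[i]]_N)
    (x y : 'rV[R]_d) : L2field (lebesgue_rV R d) 2 N :=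
  weighted_field (fun k => - (2 * pi * dotp k y)) (fun k => 'i%C *: mode G x k).

Section coupling.
Context (R : realType) (d N : nat).
Notation momentum := 'rV[R]_d.
Notation leb := (lebesgue_rV R d).
Context (G : momentum -> 'rV[R[i]]_N).
Notation mode := (mode G).
Notation coupling := (coupling G).
Notation dcoupling := (dcoupling G).
Hypothesis G0 : L2_weight (fun=> 1) G.
Hypothesis G1 : L2_weight (@enorm R 1 d) G.

Lemma measurable_mode x (c : R[i]) : measurable_fun setT (fun k => c *: mode x k).
Proof.
have [_ mG _] := G0; apply: measurable_fun_mx => i l; rewrite (ord1 i).
rewrite (_ : (fun k => _) = fun k => c * (expi (- (2 * pi * dotp k x)) * G k 0 l)).
  apply: measurable_complexM => //; apply: measurable_complexM.
    apply: measurable_expi; apply: measurable_funN; apply: measurable_funM => //.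
    exact: measurable_dotp.
  by apply: (measurableT_comp (@measurable_coord _ _ _ _ 0 l)).
by apply/funext => k; rewrite !mxE.
Qed.

Lemma csqnorm_mode x k : csqnorm (mode x k) = csqnorm (G k).
Proof. by rewrite csqnormZ sqmod_expi mul1r. Qed.

Lemma L2_weight_mode w x : L2_weight w G -> L2_weight w (mode x).
Proof.
move=> [mw _ i]; split=> //.
  by have := measurable_mode x 1; under eq_fun do rewrite scale1r.
by under eq_integral do rewrite csqnorm_mode.
Qed.

Lemma couplingE x k : coupling x k = realify (mode x k).
Proof. by rewrite coupling.unlock weighted_fieldE ?scale1r//; exact: L2_weight_mode. Qed.

Lemma L2_weight_dcoupling x y :
  L2_weight (fun k => - (2 * pi * dotp k y)) (fun k => 'i *: mode x k).
Proof.
have [mw mG iG] := G1.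
have mdot : measurable_fun setT (fun k => - (2 * pi * dotp k y)).
  by apply: measurable_funN; apply: measurable_funM => //; exact: measurable_dotp.
have m2 : measurable_fun setT (fun k : momentum => (2 * pi) ^+ 2 * sqnorm y * enorm k ^+ 2).
  by apply: measurable_funM => //; exact: measurable_funX.
apply: (@L2_weight_dominated _ _ _ _ (fun k => (2 * pi) ^+ 2 * sqnorm y * enorm k ^+ 2)) => //.
- exact: measurable_mode.
- by move=> k; rewrite mulr_ge0 ?sqr_ge0// mulr_ge0 ?sqr_ge0 ?sqnorm_ge0.
- move=> k; rewrite sqrrN exprMn -mulrA ler_wpM2l ?sqr_ge0// enorm_sqr mulrC.
  by rewrite [leRHS]mulrC mulrC; exact: dotp_CS.
under eq_integral do rewrite csqnormZ csqnorm_mode /sqmod /= expr0n expr1n add0r mul1r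
  -mulrA EFinM.
rewrite ge0_integralZl//; last 3 first.
- by apply: measurable_wcsqnorm => //; exact: measurable_funX.
- by move=> k _; rewrite lee_fin mulr_ge0 ?sqr_ge0 ?csqnorm_ge0.
- by rewrite lee_fin mulr_ge0 ?sqr_ge0 ?sqnorm_ge0.
rewrite lte_mul_pinfty// ?ge0_fin_numE//.
by rewrite lee_fin mulr_ge0 ?sqr_ge0 ?sqnorm_ge0.
Qed.

Lemma dcouplingE x y k :
  dcoupling x y k = - (2 * pi * dotp k y) *: realify ('i *: mode x k).
Proof. by rewrite dcoupling.unlock weighted_fieldE//; exact: L2_weight_dcoupling. Qed.

Lemma dcoupling_sum x y :
  dcoupling x y = \sum_j y 0 j *: dcoupling x (delta_mx 0 j).
Proof.
apply/val_inj/funext => k; rewrite /= L2field_sum dcouplingE.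
under eq_bigr do rewrite L2fieldZ dcouplingE scalerA.
rewrite -scaler_suml; congr (_ *: _); rewrite /dotp mulr_sumr -sumrN.
apply: eq_bigr => j _; rewrite (bigD1 j)//= big1 => [|j' /negbTE jj'].
  by rewrite mxE !eqxx /= mulr1n mulr1 addr0; ring.
by rewrite mxE jj' andbF mulr0.
Qed.

(** Dominated convergence: for increments h small enough, the difference quotient at k is
    bounded by a multiple of |k| |G k|, which is square integrable by assumption. *)
Lemma coupling_derive (q : R -> momentum) (t : R) (y : momentum) :
  (forall j, h^-1 * (q (t + h) 0 j - q t 0 j) @[h --> (0 : R)^'] --> y 0 j) ->
  inner_derive (@L2inner _ _ _ leb 2 N) (coupling \o q) t (dcoupling (q t) y).
Proof.
move=> qy; rewrite /inner_derive /=.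
have dot k : is_derive t 1 (fun s => - (2 * pi * dotp k (q s))) (- (2 * pi * dotp k y)).
  apply: is_derive_dnbhs.
  rewrite (_ : (fun h => _) = (fun h => - (2 * pi *
      \sum_j k 0 j * (h^-1 * (q (t + h) 0 j - q t 0 j))))).
    apply: cvgN; apply: cvgMl_tmp; apply: cvg_sumR => j; exact: cvgMl_tmp.
  apply/funext => h.
  rewrite (_ : \sum_j _ = h^-1 * (dotp k (q (t + h)) - dotp k (q t))); last first.
    by rewrite /dotp -sumrB mulr_sumr; apply: eq_bigr => j _; ring.
  ring.
have E h k : sqnorm ((h^-1 *: (coupling (q (t + h)) - coupling (q t)) -
    dcoupling (q t) y) k) = phase_defect (- (2 * pi * dotp k (q t)))
      (- (2 * pi * dotp k (q (t + h)))) h^-1 (- (2 * pi * dotp k y)) * csqnorm (G k).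
  have -> : (h^-1 *: (coupling (q (t + h)) - coupling (q t)) - dcoupling (q t) y) k =
    h^-1 *: (realify (mode (q (t + h)) k) - realify (mode (q t) k)) -
    - (2 * pi * dotp k y) *: realify ('i *: mode (q t) k).
    by rewrite L2field_lin !couplingE dcouplingE.
  rewrite -realifyB -!realifyZ -realifyB sqnorm_realify /mode !scalerA -scalerBl.
  rewrite !scalerA -scalerBl csqnormZ; congr (_ * _).
  rewrite /sqmod /phase_defect /=; ring.
pose C := (2 * pi) ^+ 2 * (4 * (sqnorm y + 1) + 2 * sqnorm y) : R.
apply: (@L2_dominated _ _ _ _ _ _ _
  (fun k => C * sqnorm (weighted_field (@enorm R 1 d) G k))).
- rewrite (_ : _ \o _ = fun k => (C%:E * (sqnorm (weighted_field (@enorm R 1 d) G k))%:E)%E)//.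
  by apply: integrableZl => //; apply: L2pred_integrable; exact: L2field_mem.
- have qn : sqnorm (h^-1 *: (q (t + h) - q t)) @[h --> (0 : R)^'] --> sqnorm y.
    rewrite /sqnorm; apply: cvg_sumR => i; apply: cvg_sumR => j.
    rewrite (ord1 i); under eq_fun do rewrite !mxE.
    by rewrite expr2; under eq_fun do rewrite expr2; apply: cvgM.
  have : \forall h \near (0 : R)^', sqnorm (h^-1 *: (q (t + h) - q t)) <= sqnorm y + 1.
    by apply: (cvgr_le _ qn); rewrite ltrDl.
  apply: filterS => h hb k; rewrite E weighted_fieldE// sqnormZ sqnorm_realify mulrA.
  apply: ler_wpM2r; first exact: csqnorm_ge0.
  apply: le_trans (phase_defect_le _ _ _ _) _; rewrite enorm_sqr.
  have -> : - (2 * pi * dotp k (q (t + h))) - - (2 * pi * dotp k (q t)) =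
     - (2 * pi) * dotp k (q (t + h) - q t).
    by rewrite !dotpE (innerBr (@frob_inner R 1 d)); ring.
  rewrite sqrrN !exprMn sqrrN.
  have h1 : h^-1 ^+ 2 * dotp k (q (t + h) - q t) ^+ 2 <= sqnorm k * (sqnorm y + 1).
    rewrite -exprMn; have -> : h^-1 * dotp k (q (t + h) - q t) =
       dotp k (h^-1 *: (q (t + h) - q t)) by rewrite !dotpE (innerZr (@frob_inner R 1 d)).
    by apply: le_trans (dotp_CS _ _) _; rewrite ler_wpM2l ?sqnorm_ge0.
  have h2 := dotp_CS k y.
  rewrite -exprMn; have p0 := sqr_ge0 (2 * pi : R).
  have := ler_wpM2l p0 h1; have := ler_wpM2l p0 h2; rewrite /C; lra.
move=> x; rewrite (funext (E^~ x)).
rewrite -[X in _ --> X](mul0r (csqnorm (G x))); apply: cvgMr_tmp.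
exact: (phase_defect_cvg (dot x)).
Qed.

End coupling.

(** * The vector potential as an inner product *)

Section charge_coupling.
Context (R : realType) (n d : nat).
Notation momentum := 'rV[R]_d.
Notation leb := (lebesgue_rV R d).
Context (chi : 'I_n -> momentum -> R[i]) (eps : 'I_d.-1 -> momentum -> momentum).
Hypothesis eps_pol : polarization_vectors eps.
Hypothesis chi_lo : forall i, square_integrable (fun k => ((enorm k)^-1)%:C * chi i k).
Hypothesis chi_hi :
  forall i, square_integrable (fun k => (enorm k `^ 2^-1)%:C * chi i k).

(** Coefficient of the plane waves in the nu-th coordinate of the potential of particle i; 2 is
    the factor in z + conj z = 2 Re z. *)
Definition form_factor i (nu : 'I_d) (k : momentum) : 'rV[R[i]]_d.-1 :=
  \row_l ((2 * (eps l k 0 nu / Num.sqrt (2 * enorm k)))%:C * chi i k).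

(** The diagonal entries of the Gram matrix of an orthonormal frame are 1. *)
Lemma eps_le1 : {ae leb, forall k l nu, (eps l k 0 nu) ^+ 2 <= 1}.
Proof.
have [_] := eps_pol; apply: filterS => k /= [fr _] l nu.
have /matrixP/(_ (lshift 1 l) (lshift 1 l)) := fr.
rewrite !mxE eqxx => fr1; rewrite -[leRHS]fr1.
under eq_bigr do rewrite !mxE (unsplitK (inl _)) !mxE.
by rewrite (bigD1 nu)//= -expr2 lerDl sumr_ge0// => j _; rewrite -expr2 sqr_ge0.
Qed.

Lemma csqnorm_form_factor i nu k : csqnorm (form_factor i nu k) =
  \sum_l 2 * eps l k 0 nu ^+ 2 * (enorm k)^-1 * sqmod (chi i k).
Proof.
apply: eq_bigr => l _; rewrite mxE sqmodM sqmodC; congr (_ * _).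
rewrite !exprMn exprVn sqr_sqrtr ?mulr_ge0 ?enorm_ge0// invfM.
by move: (enorm k)^-1 => r; field.
Qed.

Lemma measurable_form_factor i nu : measurable_fun setT (form_factor i nu).
Proof.
apply: measurable_fun_mx => i0 l; rewrite (ord1 i0).
have [mchi _] := chi_lo i; have [meps _] := eps_pol.
rewrite (_ : (fun k => _) = fun k => (2 * (eps l k 0 nu * (enorm k * 
   (Num.sqrt (2 * enorm k))^-1)))%:C * (((enorm k)^-1)%:C * chi i k)).
  apply: measurable_complexM => //; apply: measurable_complexC.
  apply: measurable_funM => //; apply: measurable_funM.
    by apply: (measurableT_comp (@measurable_coord _ _ _ _ 0 nu)).
  rewrite (_ : (fun k => _) = fun k : momentum => 2^-1 * Num.sqrt (2 * enorm k)).
    apply: measurable_funM => //.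
    apply: (@measurableT_comp _ _ _ _ _ _ (@Num.sqrt R : R -> R)).
      by apply: continuous_measurable_fun => x; exact: sqrt_continuous.
    by apply: measurable_funM => //; exact: measurable_enorm.
  apply/funext => k; have [->|k0] := eqVneq (enorm k) 0.
    by rewrite mul0r mulr0 sqrtr0 mulr0.
  have k0' : 0 < enorm k by rewrite lt_neqAle eq_sym k0 enorm_ge0.
  have s0 : Num.sqrt (2 * enorm k) != 0 by rewrite gt_eqF// sqrtr_gt0 mulr_gt0.
  apply: (mulIf s0); rewrite mulfVK// -mulrA -expr2 sqr_sqrtr ?mulr_ge0 ?enorm_ge0//.
  by rewrite mulKf// pnatr_eq0.
apply/funext => k; rewrite mxE.
have [->|k0] := eqVneq (enorm k) 0; first by rewrite !(mulr0, mul0r, sqrtr0, invr0, rmorph0).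
rewrite [RHS]mulrA -rmorphM; congr (_%:C * _).
by rewrite -!mulrA; congr (_ * (_ * _)); rewrite mulrCA mulfV ?mulr1.
Qed.

(** Almost everywhere, the squared form factor is at most a multiple of |chi|^2 / |k|. The two assumptions
    on chi make |k|^-2 |chi|^2 and |k| |chi|^2 integrable, hence also everything in between. *)
Lemma L2_weight_form_factor (w : momentum -> R) i nu : measurable_fun setT w ->
  (forall k, w k ^+ 2 * (enorm k)^-1 <= (enorm k)^-1 ^+ 2 + enorm k) ->
  L2_weight w (form_factor i nu).
Proof.
move=> mw wk; have mG := measurable_form_factor i nu; split=> //.
have [mlo ilo] := chi_lo i; have [mhi ihi] := chi_hi i.
have msq (f : momentum -> R[i]) : measurable_fun setT f ->
    measurable_fun setT (fun k => (sqmod (f k))%:E).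
  move=> mf; apply/measurable_EFinP; apply: measurable_funD; apply: measurable_funX.
    exact: measurableT_comp (@measurable_Re R) mf.
  exact: measurableT_comp (@measurable_Im R) mf.
apply: (@le_lt_trans _ _ (\int[leb]_k ((d.-1%:R * 2)%:E *
  ((sqmod (((enorm k)^-1)%:C * chi i k))%:E +
   (sqmod ((enorm k `^ 2^-1)%:C * chi i k))%:E)))%E); last first.
  rewrite ge0_integralZl//.
  - rewrite ge0_integralD//; last 4 first.
    + by move=> k _; rewrite lee_fin sqmod_ge0.
    + exact: (msq _ mlo).
    + by move=> k _; rewrite lee_fin sqmod_ge0.
    + exact: (msq _ mhi).
    by apply: lte_mul_pinfty; rewrite ?lee_fin ?mulr_ge0// lte_add_pinfty.
  - by apply: emeasurable_funD; [exact: (msq _ mlo)|exact: (msq _ mhi)].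
  - by move=> k _; rewrite adde_ge0// lee_fin sqmod_ge0.
apply: ae_ge0_le_integral => //.
- by move=> k _; rewrite lee_fin mulr_ge0 ?sqr_ge0 ?csqnorm_ge0.
- by apply: measurable_wcsqnorm => //; exact: measurable_funX.
- by move=> k _; apply: mule_ge0; [rewrite lee_fin mulr_ge0|rewrite adde_ge0// lee_fin sqmod_ge0].
- by apply: measurable_funeM; apply: emeasurable_funD; [exact: (msq _ mlo)|exact: (msq _ mhi)].
apply: filterS eps_le1 => k ek _.
rewrite -EFinD -EFinM lee_fin csqnorm_form_factor !sqmodM !sqmodC.
rewrite powR12_sqrt ?enorm_ge0// sqr_sqrtr ?enorm_ge0// -mulrDl mulr_sumr.
apply: (@le_trans _ _ (\sum_(l < d.-1) 2 * (((enorm k)^-1 ^+ 2 + enorm k) * sqmod (chi i k)))).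
  apply: ler_sum => l _.
  have -> : w k ^+ 2 * (2 * eps l k 0 nu ^+ 2 / enorm k * sqmod (chi i k)) =
    (2 * (w k ^+ 2 / enorm k * sqmod (chi i k))) * eps l k 0 nu ^+ 2 by ring.
  have X0 : 0 <= 2 * (w k ^+ 2 / enorm k * sqmod (chi i k)).
    by rewrite mulr_ge0// mulr_ge0 ?sqmod_ge0// mulr_ge0 ?sqr_ge0// invr_ge0 enorm_ge0.
  apply: le_trans (ler_wpM2l X0 (ek l nu)) _.
  by rewrite mulr1 ler_wpM2l// ler_wpM2r ?sqmod_ge0.
by rewrite sumr_const card_ord -[leLHS]mulr_natl !mulrA.
Qed.

Lemma L2_weight_form_factor0 i nu : L2_weight (fun=> 1) (form_factor i nu).
Proof.
apply: L2_weight_form_factor => // k; rewrite expr1n mul1r.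
have := enorm_ge0 k; rewrite le_eqVlt => /orP[/eqP<-|k0].
  by rewrite invr0 expr0n addr0.
have [k1|k1] := leP (enorm k) 1.
  apply: (@le_trans _ _ ((enorm k)^-1 ^+ 2)); last by rewrite lerDl ltW.
  by rewrite expr2 ler_peMl ?invr_ge0 ?(ltW k0)// invf_ge1.
apply: (@le_trans _ _ (enorm k)); last by rewrite lerDr exprn_ge0// invr_ge0 ltW.
by apply: le_trans (ltW k1); rewrite invf_le1// ltW.
Qed.

Lemma L2_weight_form_factor1 i nu : L2_weight (@enorm R 1 d) (form_factor i nu).
Proof.
apply: L2_weight_form_factor; first exact: measurable_enorm.
move=> k; have := enorm_ge0 k; rewrite le_eqVlt => /orP[/eqP<-|k0].
  by rewrite expr0n/= mul0r invr0 expr0n addr0.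
by rewrite expr2 mulfK ?gt_eqF// lerDr exprn_ge0// invr_ge0 ltW.
Qed.

Lemma L2_weight_form_factorV i nu :
  L2_weight (fun k => (Num.sqrt (enorm k))^-1) (form_factor i nu).
Proof.
apply: L2_weight_form_factor.
  rewrite (_ : (fun k => _) = fun k : momentum => Num.sqrt (enorm k) `^ (-1)).
    apply: (@measurableT_comp _ _ _ _ _ _ (@powR R ^~ (-1))).
      exact: measurable_powR.
    exact: measurable_sqrt_enorm.
  by apply/funext => k; rewrite powR_inv1// sqrtr_ge0.
by move=> k; rewrite [X in X * _]exprVn sqr_sqrtr ?enorm_ge0// -expr2 lerDl enorm_ge0.
Qed.

End charge_coupling.

Section electromagnetic_field.
Context (R : realType) (n d : nat).
Notation momentum := 'rV[R]_d.
Notation leb := (lebesgue_rV R d).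
Notation ip := (@L2inner _ _ R leb 2 d.-1).
Context (chi : 'I_n -> momentum -> R[i]) (eps : 'I_d.-1 -> momentum -> momentum).
Hypothesis eps_pol : polarization_vectors eps.
Hypothesis chi_lo : forall i, square_integrable (fun k => ((enorm k)^-1)%:C * chi i k).
Hypothesis chi_hi :
  forall i, square_integrable (fun k => (enorm k `^ 2^-1)%:C * chi i k).

Let G i nu := form_factor chi eps i nu.
Let G0 i nu : L2_weight (fun=> 1) (G i nu) :=
  L2_weight_form_factor0 eps_pol chi_lo chi_hi i nu.
Let G1 i nu : L2_weight (@enorm R 1 d) (G i nu) :=
  L2_weight_form_factor1 eps_pol chi_lo chi_hi i nu.

(** The integrand z + conj z is twice the real part of z, that is, the real inner product
    of the amplitude with the plane wave; the factor 2 is part of the form factor. *)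
Lemma vector_potentialE i nu x (a : momentum -> 'rV[R[i]]_d.-1)
    (F : L2field leb 2 d.-1) : (forall k, F k = realify (a k)) ->
  vector_potential chi eps i x a 0 nu = ip (coupling (G i nu) x) F.
Proof.
move=> Fa; rewrite mxE L2innerE exchange_big /=; apply: eq_bigr => l _.
rewrite big_ord_recl big_ord1.
rewrite -RintegralD//; [|exact: integrable_entry|exact: integrable_entry].
apply: eq_Rintegral => k _.
rewrite (couplingE (G0 i nu)) Fa !mxE /expi cosN sinN.
case: (chi i k) (a k 0 l) => x1 y1 [x2 y2] /=; ring.
Qed.

Lemma row_grad_potentialE i nu x (a : momentum -> 'rV[R[i]]_d.-1)
    (F : L2field leb 2 d.-1) j : (forall k, F k = realify (a k)) ->
  row_grad 0 (fun x => vector_potential chi eps i x a 0 nu) x 0 j =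
  ip (dcoupling (G i nu) x (delta_mx 0 j)) F.
Proof.
move=> Fa; rewrite mxE /partial.
rewrite (_ : (fun x => _) = fun x => ip (coupling (G i nu) x) F); last first.
  by apply/funext => z; exact: vector_potentialE.
have ipp := @L2inner_inner _ _ R leb 2 d.-1.
pose q (s : R) := x + s *: delta_mx 0 j : 'rV[R]_d.
have q0 : q 0 = x by rewrite /q scale0r addr0.
have dq : forall j', h^-1 * (q (0 + h) 0 j' - q 0 0 j') @[h --> (0 : R)^'] -->
    (delta_mx 0 j : 'rV[R]_d) 0 j'.
  move=> j'; apply: cvg_near_cst; near=> h.
  rewrite q0 /q add0r !mxE addrAC subrr add0r mulrA mulVf ?mul1r//.
  by near: h; exact: nbhs_dnbhs_neq.
have dc : inner_derive ip (coupling (G i nu) \o q) 0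
    (dcoupling (G i nu) x (delta_mx 0 j)).
  by have := coupling_derive (G0 i nu) (G1 i nu) dq; rewrite q0.
exact: derive_line (is_derive_innerl ipp F dc).
Unshelve. all: by end_near. Qed.

End electromagnetic_field.

(** * Fields of the phase space *)

Section phase_space_fields.
Context (R : realType) (n d : nat).
Notation momentum := 'rV[R]_d.
Notation leb := (lebesgue_rV R d).
Notation ip := (@L2inner _ _ R leb 2 d.-1).

Lemma measurable_field (a : field R d) : measurable_fun setT (field_fun a).
Proof. exact: measurable_funPT. Qed.

Lemma measurable_enorm_powR (s : R) :
  measurable_fun setT (fun k : momentum => (1 + enorm k ^+ 2) `^ s).
Proof.
apply: (@measurableT_comp _ _ _ _ _ _ (@powR R ^~ s)); first exact: measurable_powR.
by apply: measurable_funD => //; apply: measurable_funX; exact: measurable_enorm.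
Qed.

Lemma L2_weight_H (s : R) (w : momentum -> R) (a : momentum -> 'rV[R[i]]_d.-1) :
  measurable_fun setT w -> measurable_fun setT a ->
  (forall k, w k ^+ 2 <= (1 + enorm k ^+ 2) `^ s) ->
  (H_sqnorm s a < +oo)%E -> L2_weight w a.
Proof.
move=> mw ma wk; apply: L2_weight_dominated => //; first exact: measurable_enorm_powR.
by move=> k; exact: powR_ge0.
Qed.

Lemma L2_weight_phase_space s (w : momentum -> R) (u : phase_space R n d s) :
  measurable_fun setT w -> (forall k, w k ^+ 2 <= (1 + enorm k ^+ 2) `^ s) ->
  L2_weight w (fld u).
Proof.
by move=> mw ws; apply: (@L2_weight_H s) => //; exact: fld_fin.
Qed.

Lemma sobolev1 (k : momentum) : (1 + enorm k ^+ 2) `^ 1 = 1 + enorm k ^+ 2.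
Proof. by rewrite powRr1// addr_ge0// sqr_ge0. Qed.

Lemma weight_amp (u : phase_space R n d 1) : L2_weight (fun=> 1) (fld u).
Proof.
by apply: L2_weight_phase_space => // k; rewrite sobolev1 expr1n lerDl sqr_ge0.
Qed.

Lemma weight_freq (u : phase_space R n d 1) : L2_weight (@enorm R 1 d) (fld u).
Proof.
apply: L2_weight_phase_space; first exact: measurable_enorm.
by move=> k; rewrite sobolev1 lerDr.
Qed.

Lemma weight_sqrt (u : phase_space R n d 1) :
  L2_weight (fun k => Num.sqrt (enorm k)) (fld u).
Proof.
apply: L2_weight_phase_space; first exact: measurable_sqrt_enorm.
move=> k; rewrite sobolev1 sqr_sqrtr ?enorm_ge0//.
have := sqr_ge0 (enorm k - 1); rewrite sqrrB1; have := enorm_ge0 k.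
have := sqr_ge0 (enorm k); nra.
Qed.

Lemma weight_rate (v : phase_space R n d 0) : L2_weight (fun=> 1) (fld v).
Proof. by apply: L2_weight_phase_space => // k; rewrite powRr0 expr1n. Qed.

(** Transfers to the L2 fields the convergences that the topology of the phase spaces gives. *)
Lemma L2inner_le_H (s : R) (w : momentum -> R) (x : L2field leb 2 d.-1)
    (b : momentum -> 'rV[R[i]]_d.-1) :
  measurable_fun setT w -> measurable_fun setT b ->
  (forall k, w k ^+ 2 <= (1 + enorm k ^+ 2) `^ s) ->
  (forall k, x k = w k *: realify (b k)) ->
  ((ip x x)%:E <= H_sqnorm s b)%E.
Proof.
move=> mw mb ws xb; rewrite L2inner_sqE; apply: ge0_le_integral => //.
- by move=> k _; rewrite lee_fin sqnorm_ge0.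
- by have /integrableP[] := L2pred_integrable (L2field_mem x).
- by apply: measurable_wcsqnorm => //; exact: measurable_enorm_powR.
- move=> k _; rewrite lee_fin xb sqnormZ sqnorm_realify.
  by rewrite ler_wpM2r ?csqnorm_ge0.
Qed.

End phase_space_fields.

HB.lock Definition field_amp (R : realType) (n d : nat) (u : phase_space R n d 1) :
  L2field (lebesgue_rV R d) 2 d.-1 := weighted_field (fun=> 1) (fld u).

HB.lock Definition field_freq (R : realType) (n d : nat) (u : phase_space R n d 1) :
  L2field (lebesgue_rV R d) 2 d.-1 := weighted_field (@enorm R 1 d) (fld u).

HB.lock Definition field_sqrt (R : realType) (n d : nat) (u : phase_space R n d 1) :
  L2field (lebesgue_rV R d) 2 d.-1 := weighted_field (fun k => Num.sqrt (enorm k)) (fld u).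

HB.lock Definition rate_amp (R : realType) (n d : nat) (v : phase_space R n d 0) :
  L2field (lebesgue_rV R d) 2 d.-1 := weighted_field (fun=> 1) (fld v).

Section phase_space_norms.
Context (R : realType) (n d : nat).
Notation ip := (@L2inner _ _ R (lebesgue_rV R d) 2 d.-1).
Implicit Types (u : phase_space R n d 1) (v : phase_space R n d 0).

Lemma field_ampE u k : field_amp u k = realify (fld u k).
Proof. by rewrite field_amp.unlock (weighted_fieldE (weight_amp u)) scale1r. Qed.

Lemma field_freqE u k : field_freq u k = enorm k *: realify (fld u k).
Proof. by rewrite field_freq.unlock (weighted_fieldE (weight_freq u)). Qed.

Lemma field_sqrtE u k : field_sqrt u k = Num.sqrt (enorm k) *: realify (fld u k).
Proof. by rewrite field_sqrt.unlock (weighted_fieldE (weight_sqrt u)). Qed.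

Lemma rate_ampE v k : rate_amp v k = realify (fld v k).
Proof. by rewrite rate_amp.unlock (weighted_fieldE (weight_rate v)) scale1r. Qed.

Lemma Hdot_sqnormE u :
  Hdot_sqnorm 2^-1 (fld u) = (ip (field_sqrt u) (field_sqrt u))%:E.
Proof.
rewrite L2inner_sqE; apply: eq_integral => k _.
rewrite field_sqrtE sqnormZ sqnorm_realify sqr_sqrtr ?enorm_ge0//.
by rewrite mulfV ?pnatr_eq0// powRr1 ?enorm_ge0.
Qed.

Lemma L2_sqnormE u : L2_sqnorm (fld u) = (ip (field_amp u) (field_amp u))%:E.
Proof.
rewrite L2inner_sqE; apply: eq_integral => k _.
by rewrite field_ampE sqnorm_realify mul1r.
Qed.

Lemma ip_freq_sym u u' : ip (field_freq u) (field_amp u') = ip (field_freq u') (field_amp u).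
Proof.
apply: ae_eq_L2inner; apply: aeW => k; have fp := @frob_inner R 2 d.-1.
by rewrite !field_freqE !field_ampE !(innerZl fp) (innerC fp).
Qed.

(** Both sides are the energy of the free field: the left one is differentiated in time,
    the right one is visibly nonnegative and enters the Cauchy-Schwarz estimates. *)
Lemma ip_freq_amp u : ip (field_freq u) (field_amp u) = ip (field_sqrt u) (field_sqrt u).
Proof.
apply: ae_eq_L2inner; apply: aeW => k; have fp := @frob_inner R 2 d.-1.
rewrite field_freqE field_ampE field_sqrtE !(innerZl fp) (innerZr fp).
by rewrite mulrA -expr2 sqr_sqrtr ?enorm_ge0.
Qed.

End phase_space_norms.

(** * Solutions of the Newton-Maxwell equation *)

Section solution.
Context (R : realType) (n d : nat).
Notation momentum := 'rV[R]_d.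
Notation leb := (lebesgue_rV R d).
Notation ip := (@L2inner _ _ R leb 2 d.-1).
Context (m : 'I_n -> R) (V : 'M[R]_(n, d) -> R) (chi : 'I_n -> momentum -> R[i])
  (eps : 'I_d.-1 -> momentum -> momentum).
Hypothesis m_gt0 : forall i, 0 < m i.
Hypothesis eps_pol : polarization_vectors eps.
Hypothesis chi_lo : forall i, square_integrable (fun k => ((enorm k)^-1)%:C * chi i k).
Hypothesis chi_hi :
  forall i, square_integrable (fun k => (enorm k `^ 2^-1)%:C * chi i k).

Let ipP := @L2inner_inner _ _ R leb 2 d.-1.
Let Gf i nu := form_factor chi eps i nu.
Let G0 i nu : L2_weight (fun=> 1) (Gf i nu) :=
  L2_weight_form_factor0 eps_pol chi_lo chi_hi i nu.
Let G1 i nu : L2_weight (@enorm R 1 d) (Gf i nu) :=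
  L2_weight_form_factor1 eps_pol chi_lo chi_hi i nu.
Let GV i nu : L2_weight (fun k => (Num.sqrt (enorm k))^-1) (Gf i nu) :=
  L2_weight_form_factorV eps_pol chi_lo chi_hi i nu.

Definition charge_coupling i nu x := coupling (form_factor chi eps i nu) x.
Definition charge_dcoupling i nu x y := dcoupling (form_factor chi eps i nu) x y.

Let speedU (U : phase_space R n d 1) := speed ip m charge_coupling (mom U) (pos U) (field_amp U).
Let sourceU (U : phase_space R n d 1) := source ip m charge_coupling (mom U) (pos U) (field_amp U).

Lemma velocityE U i nu : velocity m chi eps (mom U) (pos U) (fld U) i 0 nu = speedU U i nu.
Proof.
rewrite /velocity /speedU /speed /potential !mxE; congr (_ * (_ - _)).
have := vector_potentialE eps_pol chi_lo chi_hi i nu (row i (pos U)) (field_ampE U).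
by rewrite mxE.
Qed.

Lemma forceE U i j : force m V chi eps (mom U) (pos U) (fld U) i 0 j =
  \sum_nu speedU U i nu * ip (charge_dcoupling i nu (row i (pos U)) (delta_mx 0 j)) (field_amp U)
  - partial i j V (pos U).
Proof.
rewrite /force !mxE summxE; congr (_ - _); rewrite mulr_sumr; apply: eq_bigr => nu _.
rewrite [X in _ * X = _]mxE mulrA; congr (_ * _).
  rewrite -velocityE /velocity [RHS]mxE; apply: congr1.
  by rewrite [RHS]mxE [X in _ = X + _]mxE [X in _ = _ + X]mxE.
exact: (row_grad_potentialE eps_pol chi_lo chi_hi i nu (row i (pos U)) j (field_ampE U)).
Qed.

Lemma L2inner_eq0 (F G : L2field leb 2 d.-1) :
  {ae leb, forall k, frob (F k) (G k) = 0} -> ip F G = 0.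
Proof.
move=> FG; have <- : ip 0 G = 0 by rewrite (inner0l ipP).
apply: ae_eq_L2inner; apply: filterS FG => k ->.
by rewrite (inner0l (@frob_inner R 2 d.-1)).
Qed.

Definition current_row (U : phase_space R n d 1) k : 'rV[R[i]]_d.-1 :=
  \row_l current m chi eps (mom U) (pos U) (fld U) l k.

(** The factors 1/2 in the source and 2 in the form factor cancel. The source is written with
    the plane waves that represent the potential, so that the work of the particles on the
    field and that of the field on the particles are the same inner products. *)
Lemma sourceE U k : sourceU U k = realify (current_row U k).
Proof.
have -> : sourceU U k = \sum_i \sum_nu (speedU U i nu / 2) *: realify (mode (Gf i nu) (row i (pos U)) k).
  rewrite /sourceU /source L2field_sum; apply: eq_bigr => i _.
  rewrite L2field_sum; apply: eq_bigr => nu _.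
  by rewrite L2fieldZ; congr (_ *: _); exact: couplingE (G0 i nu) _ _.
have rsum I (r : seq I) (h : I -> 'rV[R[i]]_d.-1) :
    \sum_(i <- r) realify (h i) = realify (\sum_(i <- r) h i).
  elim: r => [|i r IH]; last by rewrite !big_cons IH realifyD.
  by rewrite !big_nil; apply/matrixP => b l; rewrite !mxE; case: ifP.
under eq_bigr do under eq_bigr do rewrite -realifyZ.
under eq_bigr do rewrite rsum.
rewrite rsum; congr realify; apply/rowP => l; rewrite summxE mxE /current.
apply: eq_bigr => i _; rewrite summxE.
rewrite [dotp (row i (mom U) - _) _]/dotp rmorph_sum /= mulr_sumr mulr_suml.
apply: eq_bigr => nu _.
have -> : (row i (mom U) - vector_potential chi eps i (row i (pos U)) (fld U)) 0 nu =
    m i * speedU U i nu.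
  by rewrite -velocityE /velocity [in RHS]mxE mulrA mulfV ?mul1r// gt_eqF.
rewrite mxE [mode _ _ _ _ _]mxE [form_factor _ _ _ _ _ _ _]mxE.
move: (Num.sqrt (2 * enorm k)) (expi _) (chi i k) (speedU U i nu) (eps l k 0 nu) => s e c y z.
have m0 := lt0r_neq0 (m_gt0 i).
rewrite !rmorphM !fmorphV /=.
have mC0 : (m i)%:C != 0 by rewrite fmorph_eq0.
have two0 : (2 : R)%:C != 0 by rewrite fmorph_eq0 pnatr_eq0.
by move: (s%:C^-1) (m i)%:C (2 : R)%:C mC0 two0 => r mC two mC0 two0; field; rewrite mC0.
Qed.

(** Both facts come from i v = |k| alpha - source. Pairing it with v kills the left side.
    Pairing it with i alpha kills the frequency term, so that the growth of the L2 norm is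
    driven by the source alone. *)
Lemma field_equation U (v : phase_space R n d 0) :
  {ae leb, forall k l, 'i * fld v k 0 l =
     (enorm k)%:C * fld U k 0 l - current m chi eps (mom U) (pos U) (fld U) l k} ->
  ip (field_freq U - sourceU U) (rate_amp v) = 0 /\
  2 * `|ip (field_amp U) (rate_amp v)| <= ip (field_amp U) (field_amp U) + ip (sourceU U) (sourceU U).
Proof.
move=> eqv.
have eqk : {ae leb, forall k, realify ('i *: fld v k) =
    enorm k *: realify (fld U k) - sourceU U k}.
  apply: filterS eqv => k kv; rewrite sourceE -realifyZ -realifyB; congr realify.
  by apply/rowP => l; have := kv l; rewrite !mxE.
have fpP := @frob_inner R 2 d.-1.
split.
  apply: L2inner_eq0; apply: filterS eqk => k kv.
  by rewrite L2fieldD L2fieldN rate_ampE field_freqE -kv frob_realify_i.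
have iU : L2_weight (fun=> 1) (fun k => 'i *: fld U k).
  have [_ mU iU] := weight_amp U; split=> //.
    exact: measurable_rowZ.
  rewrite (eq_integral (fun k => (1 ^+ 2 * csqnorm (fld U k))%:E))// => k _.
  by rewrite csqnormZ /sqmod /= expr0n expr1n add0r mul1r.
pose iL := weighted_field (fun=> 1) (fun k => 'i *: fld U k) : L2field leb 2 d.-1.
have iLE k : iL k = realify ('i *: fld U k) by rewrite /iL (weighted_fieldE iU) scale1r.
have -> : ip (field_amp U) (field_amp U) = ip iL iL.
  by apply: ae_eq_L2inner; apply: aeW => k; rewrite field_ampE iLE frob_realify_ii.
have -> : ip (field_amp U) (rate_amp v) = - ip iL (sourceU U).
  rewrite -(innerNr ipP); apply: ae_eq_L2inner; apply: filterS eqk => k kv.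
  rewrite rate_ampE field_ampE iLE -frob_realify_ii kv (innerBr fpP) (innerZr fpP).
  by rewrite frob_realify_i mulr0 sub0r -(innerNr fpP).
by rewrite normrN; exact: inner_2le ipP _ _.
Qed.

Let energy (U : phase_space R n d 1) :=
  kinetic_energy ip m charge_coupling (mom U) (pos U) (field_amp U) + V (pos U) +
  ip (field_freq U) (field_amp U).

Lemma H_sqnorm_ge0 s (a : momentum -> 'rV[R[i]]_d.-1) : (0 <= H_sqnorm s a)%E.
Proof.
by apply: integral_ge0 => k _; rewrite lee_fin mulr_ge0 ?powR_ge0 ?csqnorm_ge0.
Qed.

Lemma X_sqnorm_ge_entry s (p q : 'M[R]_(n, d)) (a : momentum -> 'rV[R[i]]_d.-1) i j :
  ((p i j ^+ 2)%:E <= X_sqnorm s p q a)%E /\ ((q i j ^+ 2)%:E <= X_sqnorm s p q a)%E.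
Proof.
rewrite /X_sqnorm !enorm_sqr; split; apply: (@le_trans _ _ (sqnorm p + sqnorm q)%:E).
- by rewrite lee_fin (le_trans (sqr_entry_le p i j))// lerDl sqnorm_ge0.
- by rewrite leeDl// H_sqnorm_ge0.
- by rewrite lee_fin (le_trans (sqr_entry_le q i j))// lerDr sqnorm_ge0.
- by rewrite leeDl// H_sqnorm_ge0.
Qed.

Lemma X_sqnorm_ge_H s (p q : 'M[R]_(n, d)) (a : momentum -> 'rV[R[i]]_d.-1) :
  (H_sqnorm s a <= X_sqnorm s p q a)%E.
Proof. by rewrite leeDr// lee_fin addr_ge0 ?sqr_ge0. Qed.

Section trajectory.
Context (u : R -> phase_space R n d 1) (v : R -> phase_space R n d 0).
Hypothesis V1 : class_C1 V.
Hypothesis u_cont : forall t, X_sqdist (u s) (u t) @[s --> t] --> 0%E.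
Hypothesis u_der : forall t, X0_derivative u t (v t).
Hypothesis u_eq : forall t, newton_maxwell m V chi eps (u t) (v t).

Lemma field_derive t : inner_derive ip (fun s => field_amp (u s)) t (rate_amp (v t)).
Proof.
apply: cvg0_le (u_der t) => [h|h]; first exact: inner_ge0 ipP _.
apply: le_trans (X_sqnorm_ge_H _ _ _ _).
apply: (@L2inner_le_H _ _ 0 (fun=> 1)) => //.
- apply: measurable_rowB; last exact: measurable_field.
  by apply: measurable_rowZ; apply: measurable_rowB; exact: measurable_field.
- by move=> k; rewrite powRr0 expr1n.
move=> k; rewrite L2field_lin scale1r realifyB realifyZ realifyB; congr (_ *: (_ - _) - _).
- exact: field_ampE.
- exact: field_ampE.
- exact: rate_ampE.
Qed.

(** This is where continuity with values in X^1 is used: differentiability in X^0 alone says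
    nothing about |k| alpha. *)
Lemma field_freq_cont t :
  ip (field_freq (u (t + h)) - field_freq (u t)) (field_freq (u (t + h)) - field_freq (u t))
    @[h --> (0 : R)^'] --> (0 : R).
Proof.
have ut : X_sqdist (u (t + h)) (u t) @[h --> (0 : R)^'] --> 0%E.
  have th : t + h @[h --> (0 : R)^'] --> t.
    rewrite -[X in _ --> X]addr0; apply: cvgD; first exact: cvg_cst.
    exact: nbhs_dnbhs.
  exact: (cvg_comp _ _ th (u_cont t)).
apply: cvg0_le ut => h; first exact: inner_ge0 ipP _.
apply: le_trans (X_sqnorm_ge_H _ _ _ _).
apply: (@L2inner_le_H _ _ 1 (@enorm R 1 d)).
- exact: measurable_enorm.
- by apply: measurable_rowB; exact: measurable_field.
- by move=> k; rewrite sobolev1 lerDr.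
move=> k; rewrite realifyB scalerBr L2fieldD L2fieldN; congr (_ - _).
- exact: field_freqE.
- exact: field_freqE.
Qed.

Lemma mom_derive t i j : h^-1 * (mom (u (t + h)) i j - mom (u t) i j)
  @[h --> (0 : R)^'] --> mom (v t) i j.
Proof.
apply: cvg_sqr0; apply: cvg0_le (u_der t) => h; first exact: sqr_ge0.
set A := (X in X_sqnorm 0 X _ _); rewrite [X in X ^+ 2](_ : _ = A i j).
  by have [] := X_sqnorm_ge_entry 0 A (h^-1 *: (pos (u (t + h)) - pos (u t)) - pos (v t))
    (fun k => (h^-1)%:C *: (fld (u (t + h)) k - fld (u t) k) - fld (v t) k) i j.
by rewrite /A !mxE.
Qed.

Lemma pos_derive t i j : h^-1 * (pos (u (t + h)) i j - pos (u t) i j)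
  @[h --> (0 : R)^'] --> pos (v t) i j.
Proof.
apply: cvg_sqr0; apply: cvg0_le (u_der t) => h; first exact: sqr_ge0.
set A := (X in X_sqnorm 0 _ X _); rewrite [X in X ^+ 2](_ : _ = A i j).
  by have [] := X_sqnorm_ge_entry 0 (h^-1 *: (mom (u (t + h)) - mom (u t)) - mom (v t)) A
    (fun k => (h^-1)%:C *: (fld (u (t + h)) k - fld (u t) k) - fld (v t) k) i j.
by rewrite /A !mxE.
Qed.

Lemma energy_conserved t : energy (u t) = energy (u 0).
Proof.
apply: (@is_derive_0_is_cst _ (fun s => energy (u s))) => {}t.
have [eqp eqq eqf] := u_eq t.
apply: (@energy_derive R _ ip ipP n d m V charge_coupling charge_dcoupling V1 _ _
  (fun s => mom (u s)) (fun s => pos (u s)) (fun s => field_amp (u s))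
  (fun s => field_freq (u s)) t (mom (v t)) (pos (v t)) (rate_amp (v t))).
- by move=> i nu q s y; exact: coupling_derive.
- by move=> i nu x y; exact: dcoupling_sum.
- by move=> r s; exact: ip_freq_sym.
- exact: mom_derive.
- exact: pos_derive.
- exact: field_derive.
- exact: field_freq_cont.
- by move=> i nu; have /rowP/(_ nu) := eqq i; rewrite mxE velocityE.
- by move=> i j; have /rowP/(_ j) := eqp i; rewrite mxE forceE.
- by have [] := field_equation eqf.
Qed.

Lemma field_sqnorm_derive (t : R) :
  exists2 N' : R, is_derive t 1 (fun s => ip (field_amp (u s)) (field_amp (u s))) N' &
    `|N'| <= ip (field_amp (u t)) (field_amp (u t)) + ip (sourceU (u t)) (sourceU (u t)).
Proof.
exists (2 * ip (field_amp (u t)) (rate_amp (v t))).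
  have := is_derive_inner ipP (field_derive t) (field_derive t).
  move=> h; apply: is_derive_eq h _.
  by rewrite (innerC ipP (rate_amp (v t))); ring.
have [_ _ /field_equation[_]] := u_eq t.
by rewrite normrM ger0_norm.
Qed.

End trajectory.
(** A plane wave has modulus one, so the norm is the same at every position: the estimates
    are uniform in q. *)
Lemma mode_sqnorm (w : momentum -> R) i nu x : L2_weight w (Gf i nu) ->
  ip (weighted_field w (mode (Gf i nu) x)) (weighted_field w (mode (Gf i nu) x)) =
  ip (weighted_field w (Gf i nu)) (weighted_field w (Gf i nu)).
Proof.
move=> wG; apply: EFin_inj; rewrite (weighted_field_sqE (L2_weight_mode (G0 i nu) x wG)).
rewrite (weighted_field_sqE wG); apply: eq_integral => k _.
by rewrite csqnorm_mode.
Qed.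

Let damped_coupling i nu x : L2field leb 2 d.-1 :=
  weighted_field (fun k => (Num.sqrt (enorm k))^-1) (mode (Gf i nu) x).

(** Sharing |k|^(1/2) between the two factors bounds the potential by the energy of the
    field instead of its L2 norm. At k = 0, where the weights do not compensate, the form
    factor vanishes because of the convention for the inverse of 0. *)
Lemma potential_split i nu x (U : phase_space R n d 1) :
  ip (charge_coupling i nu x) (field_amp U) = ip (damped_coupling i nu x) (field_sqrt U).
Proof.
apply: ae_eq_L2inner; apply: aeW => k.
rewrite (couplingE (G0 i nu)) field_ampE field_sqrtE.
have -> : damped_coupling i nu x k = (Num.sqrt (enorm k))^-1 *: realify (mode (Gf i nu) x k).
  by rewrite /damped_coupling (weighted_fieldE (L2_weight_mode (G0 i nu) x (GV i nu))).
have fpP := @frob_inner R 2 d.-1.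
rewrite (innerZl fpP) (innerZr fpP) mulrA.
have [k0|k0] := eqVneq (enorm k) 0; last first.
  by rewrite mulVf ?mul1r// gt_eqF// sqrtr_gt0 lt_neqAle eq_sym k0 enorm_ge0.
rewrite k0 sqrtr0 mulr0 mul0r; have -> : mode (Gf i nu) x k = 0.
  apply/rowP => l; rewrite !mxE k0 mulr0 sqrtr0 invr0 !mulr0.
  by rewrite (rmorph0 (real_complex R)) mul0r mulr0.
have -> : realify (0 : 'rV[R[i]]_d.-1) = 0.
  by apply/matrixP => b l; rewrite !mxE; case: ifP.
by rewrite (inner0l fpP).
Qed.

(** The quantity that the energy controls from both sides. *)
Let D (U : phase_space R n d 1) := sqnorm (mom U) + ip (field_sqrt U) (field_sqrt U).
Let L (U : phase_space R n d 1) := ip (field_amp U) (field_amp U).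

(** Conservation of the energy compares momentum and field energy at times t and 0. The
    source is then bounded uniformly in time, and the differential inequality
    |N'| <= N + K for the squared L2 norm N gives exponential growth at most. *)
Lemma a_priori (M : R) : class_C1 V -> 0 <= M -> (forall q, `|V q| <= M) ->
  exists2 C, 0 <= C & forall u, strong_solution m V chi eps u -> forall t,
    D (u t) <= C * (1 + D (u 0)) /\
    L (u t) <= (L (u 0) + C * (1 + D (u 0))) * expR `|t|.
Proof.
move=> V1 M0 VM.
pose kap := \sum_i \sum_nu ip (weighted_field (fun k => (Num.sqrt (enorm k))^-1) (Gf i nu))
  (weighted_field (fun k => (Num.sqrt (enorm k))^-1) (Gf i nu)).
pose gam := \sum_i \sum_nu ip (weighted_field (fun=> 1) (Gf i nu)) (weighted_field (fun=> 1) (Gf i nu)).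
have sum_ge (h : 'I_n -> 'I_d -> R) i nu : (forall i nu, 0 <= h i nu) ->
    h i nu <= \sum_i \sum_nu h i nu.
  move=> h0; rewrite (bigD1 i)//= (bigD1 nu)//= -addrA lerDl addr_ge0 ?sumr_ge0// => j _.
  exact: sumr_ge0.
have kap0 : 0 <= kap.
  by apply: sumr_ge0 => i _; apply: sumr_ge0 => nu _; exact: inner_ge0 ipP _.
have gam0 : 0 <= gam.
  by apply: sumr_ge0 => i _; apply: sumr_ge0 => nu _; exact: inner_ge0 ipP _.
have gle i nu x : ip (charge_coupling i nu x) (charge_coupling i nu x) <= gam.
  have -> : ip (charge_coupling i nu x) (charge_coupling i nu x) =
    ip (weighted_field (fun=> 1) (Gf i nu)) (weighted_field (fun=> 1) (Gf i nu)).
    by rewrite /charge_coupling coupling.unlock; exact: (mode_sqnorm x (G0 i nu)).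
  by apply: sum_ge => ? ?; exact: inner_ge0 ipP _.
have [C0 C00 HC0] := @energy_bounds R _ ip ipP n d m charge_coupling m_gt0 kap gam M kap0 gam0 M0 gle.
have bounds (U : phase_space R n d 1) : [/\ D U <= C0 * (energy U + M),
    energy U + M <= C0 * (1 + D U) & ip (sourceU U) (sourceU U) <= C0 * (energy U + M)].
  rewrite /energy ip_freq_amp; apply: HC0.
  - exact: inner_ge0 ipP _.
  - exact: VM.
  move=> i nu; rewrite /potential potential_split.
  apply: le_trans (inner_CS ipP _ _) _; rewrite ler_wpM2r ?(inner_ge0 ipP)//.
  rewrite (mode_sqnorm _ (GV i nu)).
  by apply: sum_ge => ? ?; exact: inner_ge0 ipP _.
exists (C0 * C0); first exact: mulr_ge0.
move=> u [ucont [v [uder _ ueq]]] t.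
have en s : energy (u s) = energy (u 0) := energy_conserved V1 ucont uder ueq s.
have [_ b2 _] := bounds (u 0).
have b2' := ler_wpM2l C00 b2; rewrite mulrA in b2'.
split; first by have [b1 _ _] := bounds (u t); apply: le_trans b1 _; rewrite en.
have N's s := field_sqnorm_derive uder ueq s.
pose N' s := s2val (cid2 (N's s)).
have K0 : 0 <= C0 * C0 * (1 + D (u 0)).
  by rewrite !mulr_ge0// addr_ge0// addr_ge0 ?sqnorm_ge0// (inner_ge0 ipP).
apply: (@le_trans _ _ (L (u t) + C0 * C0 * (1 + D (u 0)))); first by rewrite lerDl.
apply: (@gronwall_abs R (fun s => L (u s)) N') => s.
  exact: (s2valP (cid2 (N's s))).
apply: le_trans (s2valP' (cid2 (N's s))) _; rewrite lerD2l.
by have [_ _ b3] := bounds (u s); apply: le_trans b3 _; rewrite en.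
Qed.

End solution.

(** * From pointwise bounds to moments *)

Section integral_bound.
Import HBNNSimple.
Local Open Scope ereal_scope.
Context d (T : measurableType d) (R : realType) (P : probability T R).

(** The integral of a nonnegative function is by definition the supremum of the integrals of
    the simple functions below it, so monotonicity holds for arbitrary functions. *)
Lemma ge0_integral_mono (f F : T -> \bar R) :
  (forall u, 0 <= f u) -> (forall u, f u <= F u) ->
  \int[P]_u f u <= \int[P]_u F u.
Proof.
move=> f0 fF; have F0 u := le_trans (f0 u) (fF u).
rewrite !ge0_integralTE//; apply: ereal_sup_le => _ /= [h hf <-].
by exists h => //= u; exact: le_trans (hf u) (fF u).
Qed.

(** A simple function h below C (1 + F) yields the measurable function max(0, h / C - 1) below
    F, and h is at most C times one plus it. Since only h is integrated, f and F are arbitrary;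
    this applies to integrands composed with the flow. *)
Lemma integral_le_affine (f F : T -> \bar R) (C : R) : (0 < C)%R ->
  (forall u, 0 <= f u) -> (forall u, 0 <= F u) ->
  (forall u, f u <= C%:E * (1 + F u)) ->
  \int[P]_u f u <= C%:E * (1 + \int[P]_u F u).
Proof.
move=> C0 f0 F0 fF; rewrite (ge0_integralTE _ f0).
apply: ge_ereal_sup => _ /= [h hf <-].
have -> : sintegral P h = \int[P]_u (h u)%:E.
  by rewrite (integral_nnsfun P measurableT) patch_setT.
(* The measurable minorant of F that comes from h. *)
pose g u : R := Num.max 0%R (C^-1 * h u - 1)%R.
have mg : measurable_fun setT g.
  by apply: measurable_maxr => //; apply: measurable_funB => //; exact: measurable_funM.
have gF : \int[P]_u (g u)%:E <= \int[P]_u F u.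
  apply: ge0_integral_mono => u; first by rewrite lee_fin le_max lexx.
  have := le_trans (hf u) (fF u); rewrite /g.
  have := F0 u; case: (F u) => [r| |]//=; last by move=> *; rewrite leey.
  rewrite lee_fin => r0; rewrite -?EFinD -?EFinM lee_fin => hr.
  by rewrite lee_fin ge_max r0/= lerBlDl -(ler_pM2l C0) mulrA mulfV ?gt_eqF// mul1r.
apply: (@le_trans _ _ (C%:E * (1 + \int[P]_u (g u)%:E))); last first.
  by apply: lee_wpmul2l; [rewrite lee_fin ltW|exact: leeD2l].
have -> : 1 = \int[P]_u (cst 1 u) :> \bar R.
  by rewrite integral_cst// mul1e; symmetry; exact: probability_setT.
rewrite -ge0_integralD//; last 2 first.
- by move=> u _; rewrite lee_fin le_max lexx.
- exact/measurable_EFinP.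
rewrite -ge0_integralZl//; last 3 first.
- by apply: emeasurable_funD => //; exact/measurable_EFinP.
- by move=> u _; rewrite adde_ge0// lee_fin le_max lexx.
- by rewrite lee_fin ltW.
apply: ge0_integral_mono => u; first by rewrite /= lee_fin.
rewrite /= -?EFinD -?EFinM lee_fin.
by rewrite -ler_pdivrMl// -lerBlDl /g le_max lexx orbT.
Qed.
End integral_bound.

Theorem proposition5p7 (R : realType) (n d : nat) (m : 'I_n -> R)
    (V : 'M[R]_(n, d) -> R)
    (phi : 'I_n -> 'rV[R]_d -> R) (chi : 'I_n -> 'rV[R]_d -> R[i])
    (eps : 'I_d.-1 -> 'rV[R]_d -> 'rV[R]_d)
    (Phi : phase_space R n d 1 -> R -> phase_space R n d 1)
    (n_ge1 : (1 <= n)%N) (d_ge3 : (3 <= d)%N) (m_gt0 : forall i, 0 < m i)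
    (eps_pol : polarization_vectors eps)
    (chi_fourier : forall i, inverse_fourier (phi i) (chi i))
    (V_C2 : class_C2 V) (V_bounded : bounded_fun V)
    (V1_bounded : forall i j, bounded_fun (partial i j V))
    (V2_bounded : forall i j i' j', bounded_fun (partial i' j' (partial i j V)))
    (chi_lo : forall i, square_integrable (fun k => ((enorm k)^-1)%:C * chi i k))
    (chi_hi : forall i, square_integrable (fun k => (enorm k `^ 2^-1)%:C * chi i k))
    (Phi_sol : forall u, strong_solution m V chi eps (Phi u) /\ Phi u 0 = u)
    (mu0 : probability (phase_space R n d 1) R)
    (mu0_energy :
      (\int[mu0]_u X_sqnorm 1 (mom u) (pos u) (fld u) < +oo)%E)
    (mu0_moment :
      (\int[mu0]_u ((enorm (mom u) ^+ 4)%:E + Hdot_sqnorm 2^-1 (fld u) ^+ 2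
                    + L2_sqnorm (fld u) ^+ 2) < +oo)%E) :
  exists2 c : R, 0 < c & forall t : R,
    (\int[mu0]_u ((enorm (mom (Phi u t)) ^+ 4)%:E
                  + Hdot_sqnorm 2^-1 (fld (Phi u t)) ^+ 2) <= c%:E)%E /\
    (\int[mu0]_u (L2_sqnorm (fld (Phi u t)) ^+ 2) <= (c * expR (c * `|t|))%:E)%E.
Proof.
have [M M0 VM] : exists2 M, 0 <= M & forall q, `|V q| <= M.
  have [M0 [_ hM]] := V_bounded.
  exists (`|M0| + 1) => [|q]; first by rewrite addr_ge0.
  by apply: hM => //; rewrite (le_lt_trans (ler_norm _))// ltrDl.
have [C C0 apr] := a_priori m_gt0 eps_pol chi_lo chi_hi V_C2.1 M0 VM.
pose T (U : phase_space R n d 1) : R := L2inner (field_sqrt U) (field_sqrt U).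
pose L (U : phase_space R n d 1) : R := L2inner (field_amp U) (field_amp U).
pose p (U : phase_space R n d 1) : R := sqnorm (mom U).
have ipP := @L2inner_inner _ _ R (lebesgue_rV R d) 2 d.-1.
have T0 U : 0 <= T U by exact: inner_ge0 ipP _.
have L0 U : 0 <= L U by exact: inner_ge0 ipP _.
have p0 U : 0 <= p U by exact: sqnorm_ge0.
have HE U : (Hdot_sqnorm 2^-1 (fld U) ^+ 2 = (T U ^+ 2)%:E)%E.
  by rewrite Hdot_sqnormE EFin_expe.
have LE U : (L2_sqnorm (fld U) ^+ 2 = (L U ^+ 2)%:E)%E.
  by rewrite L2_sqnormE EFin_expe.
have pE U : enorm (mom U) ^+ 4 = p U ^+ 2 by rewrite (exprM _ 2 2) enorm_sqr.
pose F (U : phase_space R n d 1) := ((enorm (mom U) ^+ 4)%:E + Hdot_sqnorm 2^-1 (fld U) ^+ 2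
                    + L2_sqnorm (fld U) ^+ 2)%E.
have FE U : F U = (p U ^+ 2 + T U ^+ 2 + L U ^+ 2)%:E.
  by rewrite /F HE LE pE !EFinD.
have F0 U : (0 <= F U)%E by rewrite FE lee_fin !addr_ge0 ?sqr_ge0.
have bD (U : phase_space R n d 1) t : p (Phi U t) + T (Phi U t) <= C * (1 + (p U + T U)).
  by have [sol PU] := Phi_sol U; have [+ _] := apr _ sol t; rewrite PU.
have bL (U : phase_space R n d 1) t : L (Phi U t) <= (L U + C * (1 + (p U + T U))) * expR `|t|.
  by have [sol PU] := Phi_sol U; have [_ +] := apr _ sol t; rewrite PU.
pose K := 4 + 8 * C ^+ 2.
have K0 : 0 < K by rewrite /K; have := sqr_ge0 C; lra.
pose I := fine (\int[mu0]_u F u)%E.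
have IE : (\int[mu0]_u F u = I%:E)%E.
  by rewrite fineK// ge0_fin_numE// integral_ge0.
have I0 : 0 <= I by rewrite /I fine_ge0// integral_ge0.
have sqD2 (x y : R) : (x + y) ^+ 2 <= 2 * x ^+ 2 + 2 * y ^+ 2.
  by have := sqr_ge0 (x - y); rewrite sqrrB sqrrD; lra.
have D2 U : (1 + (p U + T U)) ^+ 2 <= 4 * (1 + (p U ^+ 2 + T U ^+ 2)).
  have := sqD2 1 (p U + T U); have := sqD2 (p U) (T U); rewrite expr1n; lra.
have CD2 U : (C * (1 + (p U + T U))) ^+ 2 <= 4 * C ^+ 2 * (1 + (p U ^+ 2 + T U ^+ 2)).
  by rewrite exprMn; have := ler_wpM2l (sqr_ge0 C) (D2 U); lra.
have step (f : phase_space R n d 1 -> \bar R) (k : R) : 0 < k -> (forall U, 0 <= f U)%E ->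
    (forall U, f U <= (k * (1 + (p U ^+ 2 + T U ^+ 2 + L U ^+ 2)))%:E)%E ->
    (\int[mu0]_u f u <= (k * (1 + I))%:E)%E.
  move=> k0 f0 fk; rewrite EFinM EFinD -IE; apply: integral_le_affine => // U.
  by apply: le_trans (fk U) _; rewrite EFinM EFinD -FE.
have c0 : 0 <= K * (1 + I) by apply: mulr_ge0; [exact: ltW|exact: addr_ge0].
(* The summand 2 is the exponential rate of the square of the squared L2 norm. *)
exists (K * (1 + I) + 2) => [|t]; first by lra.
split.
  apply: (@le_trans _ _ (K * (1 + I))%:E); last by rewrite lee_fin lerDl.
  apply: step => // [U|U].
    by rewrite HE pE lee_fin addr_ge0 ?sqr_ge0.
  rewrite HE pE lee_fin; apply: (@le_trans _ _ ((p (Phi U t) + T (Phi U t)) ^+ 2)).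
    by rewrite sqrrD; have := mulr_ge0 (p0 (Phi U t)) (T0 (Phi U t)); lra.
  apply: (@le_trans _ _ ((C * (1 + (p U + T U))) ^+ 2)).
    by rewrite ler_sqr ?nnegrE ?bD// ?addr_ge0// mulr_ge0// addr_ge0// addr_ge0.
  apply: le_trans (CD2 U) _.
  have h1 : 0 <= 1 + (p U ^+ 2 + T U ^+ 2) by rewrite !addr_ge0 ?sqr_ge0.
  apply: (@le_trans _ _ (K * (1 + (p U ^+ 2 + T U ^+ 2)))).
    by rewrite ler_wpM2r// /K; have := sqr_ge0 C; lra.
  by rewrite ler_pM2l//; have := sqr_ge0 (L U); lra.
have e1 : 1 <= expR `|t| by rewrite -expR0 ler_expR.
apply: (@le_trans _ _ (K * expR `|t| ^+ 2 * (1 + I))%:E).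
  apply: step => [|U|U].
  - by rewrite mulr_gt0// exprn_gt0// expR_gt0.
  - by rewrite LE lee_fin sqr_ge0.
  rewrite LE lee_fin.
  apply: (@le_trans _ _ (((L U + C * (1 + (p U + T U))) * expR `|t|) ^+ 2)).
    rewrite ler_sqr ?nnegrE ?bL// mulr_ge0 ?expR_ge0// addr_ge0// mulr_ge0// addr_ge0//.
    by rewrite addr_ge0.
  rewrite exprMn [leRHS]mulrAC ler_wpM2r ?sqr_ge0//.
  apply: le_trans (sqD2 _ _) _; have := CD2 U.
  have := mulr_ge0 (sqr_ge0 C) (sqr_ge0 (L U)).
  have := sqr_ge0 (p U); have := sqr_ge0 (T U); have := sqr_ge0 (L U).
  by rewrite /K; lra.
rewrite lee_fin -expRM_natl.
apply: (@le_trans _ _ (K * (1 + I) * expR ((K * (1 + I) + 2) * `|t|))).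
  rewrite [leLHS]mulrAC ler_wpM2l// ler_expR.
  by rewrite ler_wpM2r// lerDr.
by rewrite ler_wpM2r ?expR_ge0// lerDl.
Qed.
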